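(* Let $m\ge 2$ be odd. The ring $K_0(\mathcal{A}_{4m})$ has the following fusion rules, where $i,j\in\{1,\dots,(m-1)/2\}$ and $\varepsilon,\delta,\alpha\in\{1,-1\}$: $$\pi^\varepsilon_i(u,v)\otimes\pi^{+1}_j(x,y)=\begin{cases}\pi^{\varepsilon}_{i-j}(uy,vx)\oplus\pi^{\varepsilon}_{i+j}(ux,vy)& i+j\le\frac{m-1}{2},\ i-j\ge0\\ \pi^{\varepsilon}_{j-i}(vx,uy)\oplus\pi^{\varepsilon}_{i+j}(ux,vy)& i+j\le\frac{m-1}{2},\ i-j\le0\\ \pi^{\varepsilon}_{i-j}(uy,vx)\oplus\pi^{\varepsilon}_{m-i-j}(vy,ux)& i+j>\frac{m-1}{2},\ i-j\ge0\\ \pi^{\varepsilon}_{j-i}(vx,uy)\oplus\pi^{\varepsilon}_{m-i-j}(vy,ux)& i+j>\frac{m-1}{2},\ i-j\le0,\end{cases}$$ $$\pi^\varepsilon_i(u,v)\otimes\pi^{-1}_j(x,y)=\begin{cases}\pi^{-\varepsilon}_{i-j}(\lambda^ivy,ux)\oplus\pi^{-\varepsilon}_{i+j}(\lambda^ivx,uy)& i+j\le\frac{m-1}{2},\ i-j\ge0\\ \pi^{-\varepsilon}_{j-i}(ux,\lambda^ivy)\oplus\pi^{-\varepsilon}_{i+j}(\lambda^ivx,uy)& i+j\le\frac{m-1}{2},\ i-j\le0\\ \pi^{-\varepsilon}_{i-j}(\lambda^ivy,ux)\oplus\pi^{-\varepsilon}_{m-i-j}(uy,\lambda^ivx)& i+j>\frac{m-1}{2},\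 i-j\ge0\\ \pi^{-\varepsilon}_{j-i}(ux,\lambda^ivy)\oplus\pi^{-\varepsilon}_{m-i-j}(uy,\lambda^ivx)& i+j>\frac{m-1}{2},\ i-j\le0,\end{cases}$$ $$T_{\alpha,\alpha,\varepsilon}(t)\otimes\pi^\delta_i(u,v)=\pi^{\varepsilon\delta}_i(tu,\alpha tv),\qquad \pi^\delta_i(u,v)\otimes T_{\alpha,\alpha,1}(t)=\pi^\delta_i(ut,\alpha vt),$$ $$\pi^\delta_i(u,v)\otimes T_{\alpha,\alpha,-1}(t)=\pi^{-\delta}_i(\lambda^ivt,\alpha ut),$$ $$T_{\alpha,\alpha,\varepsilon}(t)\otimes T_{1,1,\delta}(s)=T_{\alpha,\alpha,\varepsilon\delta}(ts),\qquad T_{\alpha,\alpha,\varepsilon}(t)\otimes T_{-1,-1,\delta}(s)=T_{-\alpha,-\alpha,\varepsilon\delta}(ts).$$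
   Context: Ground field $\Bbbk=\mathbb{C}$. $K_0(H)$ is the Grothendieck ring of finite-dimensional left $H$-modules, with product given by tensor product. $\mathcal{A}_{4m}$ (Masuoka), $m\ge2$: generated by $a,s_+,s_-$ with $a$ central and grouplike, $a^2=1$, $s_\pm^2=1$, $(s_+s_-)^m=1$. With $e_0=(1+a)/2$, $e_1=(1-a)/2$: $\Delta(s_\pm)=s_\pm\otimes e_0s_\pm+s_\mp\otimes e_1s_\pm$, $\epsilon(s_\pm)=1$, $S(s_\pm)=e_0s_\pm+e_1s_\mp$. It has dimension $4m$. Let $\lambda=e^{2\pi\sqrt{-1}/m}$. $T_{c_1,c_2,c_3}(t)$ is the one-dimensional module $\Bbbk t$ on which $s_+,s_-,a$ act by $c_1,c_2,c_3$. For $0\le i\le(m-1)/2$ and $\varepsilon=\pm1$, $\pi_i^\varepsilon(u,v)$ is the two-dimensional module with ordered basis $u,v$ and $s_+u=v$, $s_+v=u$, $s_-u=\lambda^iv$, $s_-v=\lambda^{-i}u$, $a$ acting by $\varepsilon$ (the modules $\pi^\varepsilon_0$ are reducible). An equality such as $M\otimes N=\pi(U,V)\oplus\pi(U',V')$ means that $M\otimes N$ is the direct sum of the submodules with the displayed ordered bases, on which the generators act by the formulas of the named module. We write $ux$ for $u\otimes x$, etc. *)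

(* Defs.v *)
From HB Require Import structures.
From mathcomp Require Import all_boot all_order all_algebra generic_quotient.
From mathcomp Require Import complex mxtens.
From mathcomp Require Import boolp reals trigo ring.

Set Implicit Arguments.
Unset Strict Implicit.
Unset Printing Implicit Defensive.
Import Order.TTheory GRing.Theory Num.Theory.
Local Open Scope ring_scope.

(* A unital associative F-algebra, as a ring A with a ring morphism from F to *)
(* the centre of A. MathComp's algType excludes the zero ring, which has to   *)
(* be allowed here: it is the endomorphism ring of the zero module.           *)
HB.mixin Record isPzAlgebra (F : fieldType) A of GRing.PzRing A := {
  scal : F -> A;
  scal1 : scal 1 = 1;
  scalD : {morph scal : c d / c + d};
  scalM : {morph scal : c d / c * d};
  scalC : forall c (x : A), scal c * x = x * scal c
}.

#[short(type="pzAlgType")]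
HB.structure Definition PzAlgebra (F : fieldType) :=
  {A of GRing.PzRing A & isPzAlgebra F A}.

HB.instance Definition _ (F : fieldType) :=
  isPzAlgebra.Build F F (erefl 1) (fun _ _ => erefl) (fun _ _ => erefl)
    (fun c x : F => mulrC c x).

Definition base_alg (F : fieldType) : pzAlgType F := F.

HB.instance Definition _ (F : fieldType) (n : nat) :=
  isPzAlgebra.Build F 'M[F]_n (erefl _) (raddfD (@scalar_mx F n))
    (@scalar_mxM F n) (fun c A => esym (scalar_mxC c A)).

Section PzAlgebraTheory.
Variables (F : fieldType) (A : pzAlgType F).
Lemma scal0 : scal 0 = 0 :> A.
Proof. by apply: (addIr (scal 0)); rewrite -scalD !add0r. Qed.
End PzAlgebraTheory.

Record ahom (F : fieldType) (A B : pzAlgType F) := AHom {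
  ahom_fun :> A -> B;
  ahomD : {morph ahom_fun : x y / x + y};
  ahomM : {morph ahom_fun : x y / x * y};
  ahom_cst : forall c : F, ahom_fun (scal c) = scal c
}.

Section AHomTheory.
Variables (F : fieldType) (A B C : pzAlgType F).

Section One.
Variable f : ahom A B.
Lemma ahom0 : f 0 = 0. Proof. by rewrite -(scal0 A) ahom_cst scal0. Qed.
Lemma ahom1 : f 1 = 1. Proof. by rewrite -scal1 ahom_cst scal1. Qed.
Lemma ahomN : {morph f : x / - x}.
Proof. by move=> x; apply: (addIr (f x)); rewrite -ahomD !addNr ahom0. Qed.
Lemma ahomX n : {morph f : x / x ^+ n}.
Proof.
by move=> x; elim: n => [|n IH]; rewrite ?expr0 ?ahom1 // !exprS ahomM IH.
Qed.
End One.

Section Comp.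
Variables (g : ahom B C) (f : ahom A B).
Let h := g \o f.
Fact ahom_compD : {morph h : x y / x + y}.
Proof. by move=> x y; rewrite /h /= !ahomD. Qed.
Fact ahom_compM : {morph h : x y / x * y}.
Proof. by move=> x y; rewrite /h /= !ahomM. Qed.
Fact ahom_comp_cst c : h (scal c) = scal c.
Proof. by rewrite /h /= !ahom_cst. Qed.
Definition ahom_comp : ahom A C := AHom ahom_compD ahom_compM ahom_comp_cst.
End Comp.
End AHomTheory.

Section Presented.
Variables (F : fieldType) (X : Type).

Inductive term : Type :=
| TGen of X | TCst of F | TAdd of term & term | TMul of term & term.

HB.instance Definition _ := gen_eqMixin term.
HB.instance Definition _ := gen_choiceMixin term.

Definition tpow (t : term) (n : nat) : term := iter n (TMul t) (TCst 1).

Fixpoint teval (B : pzAlgType F) (f : X -> B) (t : term) : B :=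
  match t with
  | TGen x => f x
  | TCst c => scal c
  | TAdd s t => teval f s + teval f t
  | TMul s t => teval f s * teval f t
  end.

Lemma teval_pow (B : pzAlgType F) (f : X -> B) t n :
  teval f (tpow t n) = teval f t ^+ n.
Proof. by elim: n => [|n IH] /=; rewrite ?scal1 ?expr0 // IH exprS. Qed.

Variable rel : term -> term -> Prop.

(* The least congruence containing rel and the axioms of F-algebras. *)
Inductive tcong : term -> term -> Prop :=
| TC_rel s t : rel s t -> tcong s t
| TC_refl t : tcong t t
| TC_sym s t : tcong s t -> tcong t s
| TC_trans s t u : tcong s t -> tcong t u -> tcong s u
| TC_add s s' t t' : tcong s s' -> tcong t t' -> tcong (TAdd s t) (TAdd s' t')
| TC_mul s s' t t' : tcong s s' -> tcong t t' -> tcong (TMul s t) (TMul s' t')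
| TC_addA s t u : tcong (TAdd s (TAdd t u)) (TAdd (TAdd s t) u)
| TC_addC s t : tcong (TAdd s t) (TAdd t s)
| TC_add0 t : tcong (TAdd (TCst 0) t) t
| TC_mulA s t u : tcong (TMul s (TMul t u)) (TMul (TMul s t) u)
| TC_mul1 t : tcong (TMul (TCst 1) t) t
| TC_mul0 t : tcong (TMul (TCst 0) t) (TCst 0)
| TC_mulDl s t u : tcong (TMul (TAdd s t) u) (TAdd (TMul s u) (TMul t u))
| TC_mulDr s t u : tcong (TMul s (TAdd t u)) (TAdd (TMul s t) (TMul s u))
| TC_cstD c d : tcong (TCst (c + d)) (TAdd (TCst c) (TCst d))
| TC_cstM c d : tcong (TCst (c * d)) (TMul (TCst c) (TCst d))
| TC_cstC c t : tcong (TMul (TCst c) t) (TMul t (TCst c)).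

Definition tcongb (s t : term) : bool := `[< tcong s t >].

Fact tcongb_refl : reflexive tcongb.
Proof. by move=> t; apply/asboolP; apply: TC_refl. Qed.
Fact tcongb_sym : symmetric tcongb.
Proof. by move=> s t; apply/asboolP/asboolP; apply: TC_sym. Qed.
Fact tcongb_trans : transitive tcongb.
Proof.
by move=> t s u /asboolP st /asboolP tu; apply/asboolP; apply: TC_trans st tu.
Qed.

Canonical tcongb_equiv := EquivRel tcongb tcongb_refl tcongb_sym tcongb_trans.

Definition presalg : Type := {eq_quot tcongb}%qT.
HB.instance Definition _ := Choice.on presalg.

Definition pcls (t : term) : presalg := (\pi_({eq_quot tcongb}%qT) t)%qT.
Definition prep (x : presalg) : term := repr (x : {eq_quot tcongb}%qT).
Definition pgen (x : X) : presalg := pcls (TGen x).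

Lemma prepK x : pcls (prep x) = x.
Proof. by rewrite /pcls /prep reprK. Qed.

Lemma pcls_eq s t : tcong s t -> pcls s = pcls t.
Proof. by move=> st; apply/eqmodP; apply/asboolP. Qed.

Lemma prep_cls t : tcong (prep (pcls t)) t.
Proof. by have /eqmodP /asboolP := prepK (pcls t). Qed.

Lemma pcls_ind (P : presalg -> Prop) : (forall t, P (pcls t)) -> forall x, P x.
Proof. by move=> H x; rewrite -[x]prepK. Qed.

Definition padd x y := pcls (TAdd (prep x) (prep y)).
Definition popp x := pcls (TMul (TCst (-1)) (prep x)).
Definition pmul x y := pcls (TMul (prep x) (prep y)).

Lemma paddE s t : padd (pcls s) (pcls t) = pcls (TAdd s t).
Proof. by apply: pcls_eq; apply: TC_add; apply: prep_cls. Qed.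
Lemma pmulE s t : pmul (pcls s) (pcls t) = pcls (TMul s t).
Proof. by apply: pcls_eq; apply: TC_mul; apply: prep_cls. Qed.
Lemma poppE s : popp (pcls s) = pcls (TMul (TCst (-1)) s).
Proof.
by apply: pcls_eq; apply: TC_mul; [apply: TC_refl | apply: prep_cls].
Qed.

Ltac pax H :=
  repeat (let t := fresh "t" in elim/pcls_ind => t);
  rewrite ?(paddE, poppE, pmulE); apply: pcls_eq; apply: H.

Fact paddA : associative padd. Proof. pax TC_addA. Qed.
Fact paddC : commutative padd. Proof. pax TC_addC. Qed.
Fact padd0 : left_id (pcls (TCst 0)) padd. Proof. pax TC_add0. Qed.
Fact pmulA : associative pmul. Proof. pax TC_mulA. Qed.
Fact pmul1l : left_id (pcls (TCst 1)) pmul. Proof. pax TC_mul1. Qed.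
Fact pcstC c x : pmul (pcls (TCst c)) x = pmul x (pcls (TCst c)).
Proof. by move: x; pax TC_cstC. Qed.
Fact pmul1r : right_id (pcls (TCst 1)) pmul.
Proof. by move=> x; rewrite -pcstC pmul1l. Qed.
Fact pmulDl : left_distributive pmul padd. Proof. pax TC_mulDl. Qed.
Fact pmulDr : right_distributive pmul padd. Proof. pax TC_mulDr. Qed.
Fact pcstD c d : pcls (TCst (c + d)) = padd (pcls (TCst c)) (pcls (TCst d)).
Proof. pax TC_cstD. Qed.
Fact pcstM c d : pcls (TCst (c * d)) = pmul (pcls (TCst c)) (pcls (TCst d)).
Proof. pax TC_cstM. Qed.

Fact pmul0 x : pmul (pcls (TCst 0)) x = pcls (TCst 0).
Proof. by move: x; pax TC_mul0. Qed.
Fact paddN : left_inverse (pcls (TCst 0)) popp padd.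
Proof.
elim/pcls_ind => t; rewrite poppE -pmulE.
by rewrite -{2}[pcls t]pmul1l -pmulDl -pcstD addNr pmul0.
Qed.

HB.instance Definition _ :=
  GRing.isZmodule.Build presalg paddA paddC padd0 paddN.
HB.instance Definition _ :=
  GRing.Zmodule_isPzRing.Build presalg pmulA pmul1l pmul1r pmulDl pmulDr.
HB.instance Definition _ :=
  isPzAlgebra.Build F presalg (erefl (1 : presalg)) pcstD pcstM pcstC.

Lemma pclsE t : pcls t = teval pgen t.
Proof.
elim: t => //= s IHs t IHt; first by rewrite -IHs -IHt -paddE.
by rewrite -IHs -IHt -pmulE.
Qed.

Lemma prelE s t : rel s t -> teval pgen s = teval pgen t.
Proof. by move=> st; rewrite -!pclsE; apply: pcls_eq; apply: TC_rel. Qed.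

Lemma presalg_ind (P : presalg -> Prop) :
  (forall x, P (pgen x)) -> (forall c, P (scal c)) ->
  (forall x y, P x -> P y -> P (x + y)) ->
  (forall x y, P x -> P y -> P (x * y)) -> forall x, P x.
Proof.
move=> Pg Pc PD PM; elim/pcls_ind => t; rewrite pclsE.
by elim: t => //= *; [apply: PD|apply: PM].
Qed.

Lemma ahom_ext (B : pzAlgType F) (f g : ahom presalg B) :
  (forall x, f (pgen x) = g (pgen x)) -> f =1 g.
Proof.
move=> fg; elim/presalg_ind => // [c|x y|x y]; first by rewrite !ahom_cst.
  by rewrite !ahomD => -> ->.
by rewrite !ahomM => -> ->.
Qed.

Section Lift.
Variables (B : pzAlgType F) (f : X -> B).
Hypothesis f_rel : forall s t, rel s t -> teval f s = teval f t.

Lemma teval_cong s t : tcong s t -> teval f s = teval f t.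
Proof.
elim=> //=.
- by move=> s' t' u _ -> _ ->.
- by move=> s1 s2 t1 t2 _ -> _ ->.
- by move=> s1 s2 t1 t2 _ -> _ ->.
- by move=> *; rewrite addrA.
- by move=> *; rewrite addrC.
- by move=> *; rewrite scal0 add0r.
- by move=> *; rewrite mulrA.
- by move=> *; rewrite scal1 mul1r.
- by move=> *; rewrite scal0 mul0r.
- by move=> *; rewrite mulrDl.
- by move=> *; rewrite mulrDr.
- by move=> *; rewrite scalD.
- by move=> *; rewrite scalM.
- by move=> *; rewrite scalC.
Qed.

Let h (x : presalg) : B := teval f (prep x).

Let hE t : h (pcls t) = teval f t.
Proof. by apply: teval_cong; apply: prep_cls. Qed.

Fact pliftD : {morph h : x y / x + y}.
Proof.
elim/pcls_ind => s; elim/pcls_ind => t.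
by have -> : pcls s + pcls t = pcls (TAdd s t); rewrite ?hE // -paddE.
Qed.
Fact pliftM : {morph h : x y / x * y}.
Proof.
elim/pcls_ind => s; elim/pcls_ind => t.
by have -> : pcls s * pcls t = pcls (TMul s t); rewrite ?hE // -pmulE.
Qed.
Fact plift_cst c : h (scal c) = scal c. Proof. exact: hE. Qed.
Definition plift : ahom presalg B := AHom pliftD pliftM plift_cst.

Lemma plift_gen x : plift (pgen x) = f x.
Proof. exact: hE. Qed.
End Lift.
End Presented.

Arguments TCst {F X} _.
Arguments TGen {F X} _.

Section TensorMatrix.
Variable F : fieldType.

Lemma tensmxDl m n p q (A A' : 'M[F]_(m, n)) (B : 'M_(p, q)) :
  (A + A') *t B = A *t B + A' *t B.
Proof. by apply/matrixP=> i j; rewrite !mxE mulrDl. Qed.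

Lemma tensmxDr m n p q (A : 'M[F]_(m, n)) (B B' : 'M_(p, q)) :
  A *t (B + B') = A *t B + A *t B'.
Proof. by apply/matrixP=> i j; rewrite !mxE mulrDr. Qed.

Lemma tensmx_cst m n (c : F) : (c%:M : 'M_m) *t (1%:M : 'M_n) = c%:M.
Proof.
apply/matrixP=> i j.
case: (mxtens_indexP i)=> i0 i1; case: (mxtens_indexP j)=> j0 j1.
rewrite tensmxE !mxE (can_eq (@mxtens_indexK m n)) xpair_eqE.
by case: (i0 == j0); case: (i1 == j1); rewrite ?(mulr0, mul0r, mulr1).
Qed.

Lemma tens1mx_cst m n (c : F) : (1%:M : 'M_m) *t (c%:M : 'M_n) = c%:M.
Proof.
apply/matrixP=> i j.
case: (mxtens_indexP i)=> i0 i1; case: (mxtens_indexP j)=> j0 j1.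
rewrite tensmxE !mxE (can_eq (@mxtens_indexK m n)) xpair_eqE.
by case: (i0 == j0); case: (i1 == j1); rewrite ?(mulr0, mul0r, mul1r).
Qed.
Lemma tensmxA m n p q r s (A : 'M[F]_(m, n)) (B : 'M_(p, q)) (C : 'M_(r, s)) :
  castmx (esym (mulnA _ _ _), esym (mulnA _ _ _)) ((A *t B) *t C) =
  A *t (B *t C).
Proof.
apply/matrixP=> i j.
case: (mxtens_indexP i)=> i0 k; case: (mxtens_indexP k)=> i1 i2.
case: (mxtens_indexP j)=> j0 l; case: (mxtens_indexP l)=> j1 j2.
have ix a b c (x : 'I_a) (y : 'I_b) (z : 'I_c) (e : (a * (b * c) = a * b * c)%N) :
    cast_ord e (mxtens_index (x, mxtens_index (y, z))) =
    mxtens_index (mxtens_index (x, y), z).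
  by apply: val_inj; rewrite /= mulnDl mulnA addnA.
by rewrite castmxE !ix !tensmxE mulrA.
Qed.
End TensorMatrix.

Section TensorAlgebra.
Variables (F : fieldType) (A B : pzAlgType F).

Notation gl a := (TGen (inl a)).
Notation gr b := (TGen (inr b)).

(* A (x) B is presented by the elements a (x) 1 and 1 (x) b: each family is   *)
(* an F-algebra morphism in its argument, and the two families commute.       *)
Inductive tens_rel : term F (A + B) -> term F (A + B) -> Prop :=
| TR_addl a a' : tens_rel (gl (a + a')) (TAdd (gl a) (gl a'))
| TR_mull a a' : tens_rel (gl (a * a')) (TMul (gl a) (gl a'))
| TR_cstl c : tens_rel (gl (scal c)) (TCst c)
| TR_addr b b' : tens_rel (gr (b + b')) (TAdd (gr b) (gr b'))
| TR_mulr b b' : tens_rel (gr (b * b')) (TMul (gr b) (gr b'))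
| TR_cstr c : tens_rel (gr (scal c)) (TCst c)
| TR_comm a b : tens_rel (TMul (gl a) (gr b)) (TMul (gr b) (gl a)).

Definition tensalg : pzAlgType F := presalg tens_rel.

Definition tens_l (a : A) : tensalg := pgen tens_rel (inl a).
Definition tens_r (b : B) : tensalg := pgen tens_rel (inr b).
Definition pure (a : A) (b : B) : tensalg := tens_l a * tens_r b.

Lemma tlD a a' : tens_l (a + a') = tens_l a + tens_l a'. Proof. exact: prelE (TR_addl a a'). Qed.
Lemma tlM a a' : tens_l (a * a') = tens_l a * tens_l a'. Proof. exact: prelE (TR_mull a a'). Qed.
Lemma tl_cst c : tens_l (scal c) = scal c. Proof. exact: prelE (TR_cstl c). Qed.
Lemma trD b b' : tens_r (b + b') = tens_r b + tens_r b'. Proof. exact: prelE (TR_addr b b'). Qed.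
Lemma trM b b' : tens_r (b * b') = tens_r b * tens_r b'. Proof. exact: prelE (TR_mulr b b'). Qed.
Lemma tr_cst c : tens_r (scal c) = scal c. Proof. exact: prelE (TR_cstr c). Qed.
Lemma tlrC a b : tens_l a * tens_r b = tens_r b * tens_l a. Proof. exact: prelE (TR_comm a b). Qed.

Lemma pureDl a a' b : pure (a + a') b = pure a b + pure a' b.
Proof. by rewrite /pure tlD mulrDl. Qed.
Lemma pureDr a b b' : pure a (b + b') = pure a b + pure a b'.
Proof. by rewrite /pure trD mulrDr. Qed.
Lemma pureM a a' b b' : pure a b * pure a' b' = pure (a * a') (b * b').
Proof. by rewrite /pure tlM trM !mulrA -[_ * tens_l a']mulrA -tlrC !mulrA. Qed.
Lemma pure1 : pure 1 1 = 1.
Proof. by have := tl_cst 1; have := tr_cst 1; rewrite /pure !scal1 => -> ->; rewrite mul1r. Qed.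
Lemma pure0 a : pure a 0 = 0.
Proof. by apply: (addIr (pure a 0)); rewrite -pureDr !add0r. Qed.

Section Rep.
Variables (n k : nat) (rho : ahom A 'M[F]_n) (sigma : ahom B 'M[F]_k).
Let f (x : A + B) : 'M[F]_(n * k) :=
  match x with inl a => rho a *t 1%:M | inr b => 1%:M *t sigma b end.
Fact tens_rep_rel s t : tens_rel s t -> teval f s = teval f t.
Proof.
case=> /=.
- by move=> a a'; rewrite ahomD tensmxDl.
- by move=> a a'; rewrite ahomM -!mulmxE tensmx_mul mulmx1.
- by move=> c; rewrite ahom_cst tensmx_cst.
- by move=> b b'; rewrite ahomD tensmxDr.
- by move=> b b'; rewrite ahomM -!mulmxE tensmx_mul mulmx1.
- by move=> c; rewrite ahom_cst tens1mx_cst.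
- by move=> a b; rewrite -!mulmxE !tensmx_mul !mulmx1 !mul1mx.
Qed.
(* a (x) b acts on V (x) W by v (x) w |-> a v (x) b w. *)
Definition tens_rep : ahom tensalg 'M[F]_(n * k) := plift tens_rep_rel.

Lemma tens_rep_pure a b : tens_rep (pure a b) = rho a *t sigma b.
Proof.
by rewrite ahomM !plift_gen /f -!mulmxE tensmx_mul mulmx1 mul1mx.
Qed.
End Rep.
End TensorAlgebra.

Notation "x \ox y" := (pure x y) (at level 40, left associativity).

(* Signs are booleans, b standing for (-1)^b: s_+ is [Gs false], s_- is       *)
(* [Gs true], the product of signs is addb and the opposite sign is negb.     *)
Inductive a4gen := Ga | Gs of bool.

Section A4m.
Variables (F : numFieldType) (m : nat).

Notation ta := (TGen Ga).
Notation ts b := (TGen (Gs b)).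

(* The antipode is not defined, since it does not enter the tensor product    *)
(* of modules.                                                                *)
Inductive a4rel : term F a4gen -> term F a4gen -> Prop :=
| A4_aa : a4rel (TMul ta ta) (TCst 1)
| A4_as b : a4rel (TMul ta (ts b)) (TMul (ts b) ta)
| A4_ss b : a4rel (TMul (ts b) (ts b)) (TCst 1)
| A4_dih : a4rel (tpow (TMul (ts false) (ts true)) m) (TCst 1).

Definition A4m : pzAlgType F := presalg a4rel.
Definition Ag (g : a4gen) : A4m := pgen a4rel g.
Definition Aa : A4m := Ag Ga.
Definition As (b : bool) : A4m := Ag (Gs b).

Section Lift.
Variables (B : pzAlgType F) (a : B) (s : bool -> B).
Hypothesis aa : a * a = 1.
Hypothesis as_ : forall b, a * s b = s b * a.
Hypothesis ss : forall b, s b * s b = 1.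
Hypothesis dih : (s false * s true) ^+ m = 1.
Let f g := match g with Ga => a | Gs b => s b end.
Fact A4_lift_rel t u : a4rel t u -> teval f t = teval f u.
Proof. by case=> [|b|b|]; rewrite ?teval_pow /= ?scal1. Qed.
Definition A4_lift : ahom A4m B := plift A4_lift_rel.
Lemma A4_lift_a : A4_lift Aa = a. Proof. exact: plift_gen. Qed.
Lemma A4_lift_s b : A4_lift (As b) = s b. Proof. exact: plift_gen. Qed.
End Lift.

Lemma A4_ext (B : pzAlgType F) (f g : ahom A4m B) :
  f Aa = g Aa -> (forall b, f (As b) = g (As b)) -> f =1 g.
Proof. by move=> fga fgs; apply: ahom_ext => -[|b]; [exact: fga|exact: fgs]. Qed.

Lemma Aaa : Aa * Aa = 1. Proof. by have := prelE A4_aa; rewrite /= scal1. Qed.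
Lemma Aas b : Aa * As b = As b * Aa. Proof. exact: prelE (A4_as b). Qed.
Lemma Ass b : As b * As b = 1. Proof. by have := prelE (A4_ss b); rewrite /= scal1. Qed.
Lemma Adih0 : (As false * As true) ^+ m = 1.
Proof. by have := prelE A4_dih; rewrite teval_pow /= scal1. Qed.

Lemma Adih b : (As b * As (~~ b)) ^+ m = 1.
Proof.
case: b; last exact: Adih0.
have swap n : As true * (As false * As true) ^+ n =
              (As true * As false) ^+ n * As true.
  elim: n => [|n IH]; first by rewrite !expr0 mulr1 mul1r.
  by rewrite exprSr mulrA IH exprSr -!mulrA.
have := swap m; rewrite Adih0 mulr1 => /(congr1 (fun x => x * As true)).
by rewrite -mulrA !Ass mulr1 => <-.
Qed.

(* e_0 = (1 + a) / 2 and e_1 = (1 - a) / 2. *)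
Definition Ae (k : bool) : A4m := scal 2^-1 * (1 + (if k then - Aa else Aa)).

Lemma Ae_comm k x : GRing.comm Aa x -> GRing.comm (Ae k) x.
Proof.
move=> ax; apply: commr_sym; apply: commrM; first by rewrite /GRing.comm scalC.
apply: commrD; first exact: commr1.
by case: k; [apply: commrN|]; apply: commr_sym.
Qed.
Lemma Aes k b : Ae k * As b = As b * Ae k. Proof. exact/Ae_comm/Aas. Qed.
Lemma Aea k : Aa * Ae k = Ae k * Aa. Proof. exact/esym/Ae_comm. Qed.

Lemma scal2V (A : pzAlgType F) (x : A) : scal 2^-1 * x + scal 2^-1 * x = x.
Proof.
have h : 2^-1 + 2^-1 = 1 :> F by rewrite -mulr2n -(mulr_natl 2^-1 2) divff ?pnatr_eq0.
by rewrite -mulrDl -scalD h scal1 mul1r.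
Qed.

Lemma AeD : Ae false + Ae true = 1.
Proof.
by rewrite /Ae -mulrDr addrACA subrr addr0 mulrDr scal2V.
Qed.

Lemma AeM k l : Ae k * Ae l = if k == l then Ae k else 0.
Proof.
have H (x y : A4m) : scal 2^-1 * x * (scal 2^-1 * y) = scal 2^-1 * (scal 2^-1 * (x * y)).
  by rewrite -!mulrA; congr (_ * _); rewrite !mulrA scalC.
have sq (x : A4m) : x * x = 1 -> (1 + x) * (1 + x) = (1 + x) + (1 + x).
  by move=> xx; rewrite mulrDl mul1r mulrDr mulr1 xx [x + 1]addrC.
have df (x : A4m) : x * x = 1 -> (1 + x) * (1 - x) = 0.
  move=> xx; rewrite mulrDl mul1r mulrDr mulr1 mulrN xx.
  by rewrite -[x - 1]opprB subrr.
have aN : - Aa * - Aa = 1 by rewrite mulrNN Aaa.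
rewrite {1 2}/Ae H; case: k l => [] [] /=.
- by rewrite (sq _ aN) mulrDr scal2V.
- by have := df _ aN; rewrite opprK => ->; rewrite !mulr0.
- by rewrite (df _ Aaa) !mulr0.
- by rewrite (sq _ Aaa) mulrDr scal2V.
Qed.

Local Notation AA := (tensalg A4m A4m).

(* Delta(s_b) = s_b (x) e_0 s_b + s_{-b} (x) e_1 s_b. *)
Definition Delta_s (b : bool) : AA :=
  As b \ox (Ae false * As b) + As (~~ b) \ox (Ae true * As b).

Let es k l x y : Ae k * As x * (Ae l * As y) =
  if k == l then Ae k * (As x * As y) else 0.
Proof.
rewrite mulrA -[_ * As x * _]mulrA -Aes mulrA AeM.
by case: eqP => _; rewrite ?mul0r // [RHS]mulrA.
Qed.

Let Delta_sM b c : Delta_s b * Delta_s c =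
  (As b * As c) \ox (Ae false * (As b * As c)) +
  (As (~~ b) * As (~~ c)) \ox (Ae true * (As b * As c)).
Proof. by rewrite mulrDl !mulrDr !pureM !es /= !pure0 addr0 add0r. Qed.

Let Delta_one (x x' y : A4m) : x = 1 -> x' = 1 -> y = 1 ->
  x \ox (Ae false * y) + x' \ox (Ae true * y) = 1.
Proof. by move=> -> -> ->; rewrite -pureDr !mulr1 AeD pure1. Qed.

Fact Delta_aa : (Aa \ox Aa) * (Aa \ox Aa) = 1 :> AA.
Proof. by rewrite pureM Aaa pure1. Qed.

Fact Delta_as b : (Aa \ox Aa) * Delta_s b = Delta_s b * (Aa \ox Aa).
Proof.
rewrite mulrDr mulrDl !pureM !Aas; congr (_ \ox _ + _ \ox _);
  by rewrite mulrA Aea -!mulrA Aas.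
Qed.

Fact Delta_ss b : Delta_s b * Delta_s b = 1.
Proof. by rewrite Delta_sM !Ass Delta_one. Qed.

Fact Delta_dih : (Delta_s false * Delta_s true) ^+ m = 1.
Proof.
rewrite Delta_sM /=; set p := As false * As true; set q := As true * As false.
have ep k : Ae k * p = p * Ae k by rewrite /p mulrA Aes -mulrA Aes mulrA.
have eM k l y :
    Ae k * p * (Ae l * y) = if k == l then Ae k * (p * y) else 0.
  rewrite mulrA -[_ * p * _]mulrA -ep mulrA AeM.
  by case: eqP => _; rewrite ?mul0r // [RHS]mulrA.
have Hn n : (p \ox (Ae false * p) + q \ox (Ae true * p)) ^+ n =
            p ^+ n \ox (Ae false * p ^+ n) + q ^+ n \ox (Ae true * p ^+ n).
  elim: n => [|n IH]; first by rewrite !expr0 -pureDr !mulr1 AeD pure1.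
  rewrite exprS IH mulrDl !mulrDr !pureM !eM /=.
  by rewrite !pure0 addr0 add0r !exprS.
by rewrite Hn /p /q (Adih false) (Adih true) Delta_one.
Qed.

Definition Delta : ahom A4m AA :=
  A4_lift Delta_aa Delta_as Delta_ss Delta_dih.

Lemma Delta_AaE : Delta Aa = Aa \ox Aa. Proof. exact: A4_lift_a. Qed.
Lemma Delta_AsE b : Delta (As b) = Delta_s b. Proof. exact: A4_lift_s. Qed.

Let counit_s (b : bool) : base_alg F := 1.
Fact counit_aa : (1 : base_alg F) * 1 = 1. Proof. exact: mulr1. Qed.
Fact counit_as b : 1 * counit_s b = counit_s b * 1. Proof. by []. Qed.
Fact counit_ss b : counit_s b * counit_s b = 1. Proof. exact: mulr1. Qed.
Fact counit_dih : (counit_s false * counit_s true) ^+ m = 1.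
Proof. by rewrite mulr1 expr1n. Qed.
Definition counit : ahom A4m (base_alg F) :=
  A4_lift counit_aa counit_as counit_ss counit_dih.

End A4m.

Section Intertwiners.
Variables (F : fieldType) (X : Type) (rel : term F X -> term F X -> Prop).
Variables (n k : nat) (rho : ahom (presalg rel) 'M[F]_n).
Variables (sigma : ahom (presalg rel) 'M[F]_k) (f : 'M[F]_(k, n)).
Lemma intertwines_gen :
  (forall x, f *m rho (pgen rel x) = sigma (pgen rel x) *m f) ->
  forall h, f *m rho h = sigma h *m f.
Proof.
move=> H; elim/presalg_ind => // [c|x y Hx Hy|x y Hx Hy].
- by rewrite !ahom_cst scalar_mxC.
- by rewrite !ahomD mulmxDr mulmxDl Hx Hy.
- by rewrite !ahomM -!mulmxE mulmxA Hx -mulmxA Hy mulmxA.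
Qed.
End Intertwiners.

Lemma col_eqP (F : fieldType) m n (A B : 'M[F]_(m, n)) :
  (forall j, col j A = col j B) -> A = B.
Proof.
by move=> H; apply/matrixP=> i j; have /colP/(_ i) := H j; rewrite !mxE.
Qed.

Lemma mulmx_inj (F : fieldType) m n p (A : 'M[F]_(m, n)) (X Y : 'M_(n, p)) :
  injective (fun v : 'cV_n => A *m v) -> A *m X = A *m Y -> X = Y.
Proof.
move=> injA AXY; apply: col_eqP => j; apply: injA.
by rewrite /= !colE !mulmxA AXY.
Qed.

Lemma mulmx_solve (F : fieldType) m n p (A : 'M[F]_(m, n)) (B : 'M_(m, p)) :
  (forall j, exists v : 'cV_n, A *m v = col j B) -> exists X, A *m X = B.
Proof.
move=> /choice [v Hv]; exists (\matrix_(i, j) v j i 0).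
apply: col_eqP => j; rewrite -Hv colE -mulmxA -colE; congr (_ *m _).
by apply/matrixP => i k; rewrite !mxE ord1.
Qed.

Section Modules.
Variables (F : numFieldType) (m : nat).
Local Notation A := (A4m F m).

(* A finite-dimensional left module: h acts on column vectors by [act h *m _]. *)
Record amod := AMod { mdim : nat; act : ahom A 'M[F]_mdim }.

Section Mk.
Variables (n : nat) (a : 'M[F]_n) (s : bool -> 'M[F]_n).
Hypothesis aa : a *m a = 1%:M.
Hypothesis as_ : forall b, a *m s b = s b *m a.
Hypothesis ss : forall b, s b *m s b = 1%:M.
Hypothesis dih : (s false *m s true) ^+ m = 1%:M.
Definition mkmod : amod := AMod (A4_lift aa as_ ss dih).
Lemma mkmod_a : act mkmod (Aa F m) = a. Proof. exact: A4_lift_a. Qed.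
Lemma mkmod_s b : act mkmod (As F m b) = s b. Proof. exact: A4_lift_s. Qed.
End Mk.

Definition scal_ahom (B : pzAlgType F) : ahom (base_alg F) B :=
  @AHom F (base_alg F) B (@scal F B) (@scalD F B) (@scalM F B) (fun=> erefl).

Definition munit : amod := AMod (ahom_comp (scal_ahom 'M[F]_1) (counit F m)).

Definition mtens (M N : amod) : amod :=
  AMod (ahom_comp (tens_rep (act M) (act N)) (Delta F m)).

Lemma mtens_act M N h :
  act (mtens M N) h = tens_rep (act M) (act N) (Delta F m h).
Proof. by []. Qed.

Lemma munit_act h : act munit h = (counit F m h)%:M. Proof. by []. Qed.

Lemma mtens_a M N :
  act (mtens M N) (Aa F m) = act M (Aa F m) *t act N (Aa F m).
Proof. by rewrite mtens_act Delta_AaE tens_rep_pure. Qed.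

Lemma mtens_s M N b : act (mtens M N) (As F m b) =
  act M (As F m b) *t (act N (Ae F m false) *m act N (As F m b)) +
  act M (As F m (~~ b)) *t (act N (Ae F m true) *m act N (As F m b)).
Proof.
by rewrite mtens_act Delta_AsE /Delta_s ahomD !tens_rep_pure !ahomM -!mulmxE.
Qed.

Definition intertwines (M N : amod) (f : 'M[F]_(mdim N, mdim M)) : Prop :=
  forall h : A, f *m act M h = act N h *m f.

(* 0 -> L -> M -> N -> 0 is exact for suitable module maps i and p. *)
Definition ses (L M N : amod) : Prop :=
  exists (i : 'M[F]_(mdim M, mdim L)) (p : 'M[F]_(mdim N, mdim M)),
  [/\ @intertwines L M i, @intertwines M N p,
      injective (fun u : 'cV[F]_(mdim L) => i *m u),
      forall w : 'cV[F]_(mdim N), exists v : 'cV[F]_(mdim M), p *m v = w &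
      forall v : 'cV[F]_(mdim M),
        p *m v = 0 <-> exists u : 'cV[F]_(mdim L), v = i *m u].

Lemma ses_split L M N : ses L M N ->
  exists i p r s, [/\ @intertwines L M i, @intertwines M N p &
    [/\ p *m i = 0, r *m i = 1%:M, p *m s = 1%:M & i *m r + s *m p = 1%:M]].
Proof.
move=> [i [p [Hi Hp inj sur ex]]].
have [s ps] : exists s, p *m s = 1%:M by apply: mulmx_solve => j; apply: sur.
have pi0 : p *m i = 0.
  apply: col_eqP => j; rewrite !colE mul0mx -mulmxA.
  by apply/ex; exists (delta_mx j 0).
have [r ir] : exists r, i *m r = 1%:M - s *m p.
  apply: mulmx_solve => j.
  have /ex [u ->] : p *m col j (1%:M - s *m p) = 0; last by exists u.
  by rewrite colE mulmxA mulmxBr mulmx1 mulmxA ps mul1mx subrr mul0mx.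
exists i, p, r, s; split=> //; split=> //; last by rewrite ir subrK.
apply: (mulmx_inj inj).
by rewrite mulmxA ir mulmxBl mul1mx -mulmxA pi0 mulmx0 subr0 mulmx1.
Qed.

Lemma split_ses L M N i p r s : @intertwines L M i -> @intertwines M N p ->
  p *m i = 0 -> r *m i = 1%:M -> p *m s = 1%:M -> i *m r + s *m p = 1%:M ->
  ses L M N.
Proof.
move=> Hi Hp pi0 ri ps irsp; exists i, p; split=> //.
- by move=> u v /= /(congr1 (mulmx r)); rewrite !mulmxA ri !mul1mx.
- by move=> w; exists (s *m w); rewrite mulmxA ps mul1mx.
- move=> v; split=> [pv|[u ->]]; last by rewrite mulmxA pi0 mul0mx.
  exists (r *m v); rewrite -[LHS]mul1mx -irsp mulmxDl -!mulmxA pv mulmx0.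
  by rewrite addr0.
Qed.

Lemma intertwines_l M N P f : @intertwines M N f ->
  @intertwines (mtens M P) (mtens N P) (f *t (1%:M : 'M_(mdim P))).
Proof.
move=> Hf h; rewrite !mtens_act.
apply: (@intertwines_gen _ _ _ _ _ (tens_rep (act M) (act P))
                                   (tens_rep (act N) (act P))).
by case=> x; rewrite !plift_gen /= !tensmx_mul !(mulmx1, mul1mx) ?(Hf x).
Qed.

Lemma intertwines_r M N P f : @intertwines M N f ->
  @intertwines (mtens P M) (mtens P N) ((1%:M : 'M_(mdim P)) *t f).
Proof.
move=> Hf h; rewrite !mtens_act.
apply: (@intertwines_gen _ _ _ _ _ (tens_rep (act P) (act M))
                                   (tens_rep (act P) (act N))).
by case=> x; rewrite !plift_gen /= !tensmx_mul !(mulmx1, mul1mx) ?(Hf x).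
Qed.

Lemma ses_l L M N P : ses L M N -> ses (mtens L P) (mtens M P) (mtens N P).
Proof.
move=> /ses_split [i [p [r [s [Hi Hp [pi0 ri ps irsp]]]]]].
apply: (@split_ses (mtens L P) (mtens M P) (mtens N P) (i *t 1%:M) (p *t 1%:M) (r *t 1%:M) (s *t 1%:M)).
- exact: intertwines_l.
- exact: intertwines_l.
- by rewrite tensmx_mul pi0 tens0mx.
- by rewrite tensmx_mul ri mulmx1 tensmx_cst.
- by rewrite tensmx_mul ps mulmx1 tensmx_cst.
- by rewrite !tensmx_mul mulmx1 -tensmxDl irsp tensmx_cst.
Qed.

Lemma ses_r L M N P : ses L M N -> ses (mtens P L) (mtens P M) (mtens P N).
Proof.
move=> /ses_split [i [p [r [s [Hi Hp [pi0 ri ps irsp]]]]]].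
apply: (@split_ses (mtens P L) (mtens P M) (mtens P N) (1%:M *t i) (1%:M *t p) (1%:M *t r) (1%:M *t s)).
- exact: intertwines_r.
- exact: intertwines_r.
- by rewrite tensmx_mul pi0 tensmx0.
- by rewrite tensmx_mul ri mulmx1 tensmx_cst.
- by rewrite tensmx_mul ps mulmx1 tensmx_cst.
- by rewrite !tensmx_mul mulmx1 -tensmxDr irsp tensmx_cst.
Qed.

Fact mx0_eq (B C : 'M[F]_0) : B = C.
Proof. by rewrite [B]flatmx0 [C]flatmx0. Qed.
Definition mzero : amod := @mkmod 0 0 (fun=> 0) (mx0_eq _ _)
  (fun=> mx0_eq _ _) (fun=> mx0_eq _ _) (mx0_eq _ _).

(* Equality of modules up to a cast of the dimension. *)
Lemma ses_cast M N (e : mdim M = mdim N) :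
  castmx (e, e) (act M (Aa F m)) = act N (Aa F m) ->
  (forall b, castmx (e, e) (act M (As F m b)) = act N (As F m b)) ->
  ses M N mzero.
Proof.
case: M e => n rho; case: N => k sigma /= e; case: k / e sigma => sigma.
rewrite !castmx_id => Ha Hs.
have H : rho =1 sigma.
  by apply: A4_ext => // b; rewrite -Hs castmx_id.
apply: (@split_ses (AMod rho) (AMod sigma) mzero 1%:M 0 1%:M 0) => /=.
- by move=> h; rewrite /= mul1mx mulmx1 H.
- by move=> h; rewrite /= mul0mx mulmx0.
- by rewrite mul0mx.
- by rewrite mul1mx.
- by apply/matrixP=> -[].
- by rewrite mul1mx mul0mx addr0.
Qed.

(* The free abelian group on modules modulo [M] = [L] + [N] for each short    *)
(* exact sequence 0 -> L -> M -> N -> 0.                                      *)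
Inductive kterm : Type :=
| KCls of amod | KZero | KAdd of kterm & kterm | KOpp of kterm.

HB.instance Definition _ := gen_eqMixin kterm.
HB.instance Definition _ := gen_choiceMixin kterm.

Inductive kcong : kterm -> kterm -> Prop :=
| KC_ses L M N : ses L M N -> kcong (KCls M) (KAdd (KCls L) (KCls N))
| KC_refl t : kcong t t
| KC_sym s t : kcong s t -> kcong t s
| KC_trans s t u : kcong s t -> kcong t u -> kcong s u
| KC_add s s' t t' : kcong s s' -> kcong t t' -> kcong (KAdd s t) (KAdd s' t')
| KC_opp s s' : kcong s s' -> kcong (KOpp s) (KOpp s')
| KC_addA s t u : kcong (KAdd s (KAdd t u)) (KAdd (KAdd s t) u)
| KC_addC s t : kcong (KAdd s t) (KAdd t s)
| KC_add0 t : kcong (KAdd KZero t) t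
| KC_addN t : kcong (KAdd (KOpp t) t) KZero.

Definition kcongb (s t : kterm) : bool := `[< kcong s t >].
Fact kcongb_refl : reflexive kcongb.
Proof. by move=> t; apply/asboolP; apply: KC_refl. Qed.
Fact kcongb_sym : symmetric kcongb.
Proof. by move=> s t; apply/asboolP/asboolP; apply: KC_sym. Qed.
Fact kcongb_trans : transitive kcongb.
Proof.
by move=> t s u /asboolP st /asboolP tu; apply/asboolP; apply: KC_trans st tu.
Qed.
Canonical kcongb_equiv := EquivRel kcongb kcongb_refl kcongb_sym kcongb_trans.

Definition K0 : Type := {eq_quot kcongb}%qT.
HB.instance Definition _ := Choice.on K0.

Definition kcls (t : kterm) : K0 := (\pi_({eq_quot kcongb}%qT) t)%qT.
Definition krep (x : K0) : kterm := repr (x : {eq_quot kcongb}%qT).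
Definition cls (M : amod) : K0 := kcls (KCls M).

Lemma krepK x : kcls (krep x) = x. Proof. by rewrite /kcls /krep reprK. Qed.
Lemma kcls_eq s t : kcong s t -> kcls s = kcls t.
Proof. by move=> st; apply/eqmodP; apply/asboolP. Qed.
Lemma krep_cls t : kcong (krep (kcls t)) t.
Proof. by have /eqmodP /asboolP := krepK (kcls t). Qed.
Lemma kcls_ind (P : K0 -> Prop) : (forall t, P (kcls t)) -> forall x, P x.
Proof. by move=> H x; rewrite -[x]krepK. Qed.

Definition kadd x y := kcls (KAdd (krep x) (krep y)).
Definition kopp x := kcls (KOpp (krep x)).
Lemma kaddE s t : kadd (kcls s) (kcls t) = kcls (KAdd s t).
Proof. by apply: kcls_eq; apply: KC_add; apply: krep_cls. Qed.
Lemma koppE s : kopp (kcls s) = kcls (KOpp s).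
Proof. by apply: kcls_eq; apply: KC_opp; apply: krep_cls. Qed.

Ltac kax H :=
  repeat (let t := fresh "t" in elim/kcls_ind => t);
  rewrite ?(kaddE, koppE); apply: kcls_eq; apply: H.

Fact kaddA : associative kadd. Proof. kax KC_addA. Qed.
Fact kaddC : commutative kadd. Proof. kax KC_addC. Qed.
Fact kadd0 : left_id (kcls KZero) kadd. Proof. kax KC_add0. Qed.
Fact kaddN : left_inverse (kcls KZero) kopp kadd. Proof. kax KC_addN. Qed.

HB.instance Definition _ := GRing.isZmodule.Build K0 kaddA kaddC kadd0 kaddN.

Lemma cls_ses L M N : ses L M N -> cls M = cls L + cls N.
Proof.
by move=> H; rewrite /cls -[RHS]/(kadd _ _) kaddE; apply/kcls_eq/KC_ses.
Qed.

Lemma K0_ind (P : K0 -> Prop) :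
  (forall M, P (cls M)) -> P 0 -> (forall x y, P x -> P y -> P (x + y)) ->
  (forall x, P x -> P (- x)) -> forall x, P x.
Proof.
move=> Pc P0 PD PN; elim/kcls_ind; elim=> // [s Ps t Pt|s Ps].
  by rewrite -kaddE; apply: PD.
by rewrite -koppE; apply: PN.
Qed.

Section KLift.
Variables (V : zmodType) (f : amod -> V).
Fixpoint keval (t : kterm) : V :=
  match t with
  | KCls M => f M
  | KZero => 0
  | KAdd s t => keval s + keval t
  | KOpp s => - keval s
  end.
Definition klift (x : K0) : V := keval (krep x).
Hypothesis f_ses : forall L M N, ses L M N -> f M = f L + f N.
Lemma keval_cong s t : kcong s t -> keval s = keval t.
Proof.
elim=> //=.
- by move=> s' t' u _ -> _ ->.
- by move=> s1 s2 t1 t2 _ -> _ ->.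
- by move=> s1 s2 _ ->.
- by move=> *; rewrite addrA.
- by move=> *; rewrite addrC.
- by move=> *; rewrite add0r.
- by move=> *; rewrite addNr.
Qed.
Lemma klift_kcls t : klift (kcls t) = keval t.
Proof. by apply: keval_cong; apply: krep_cls. Qed.
Lemma klift_cls M : klift (cls M) = f M. Proof. exact: klift_kcls. Qed.
Lemma kliftD : {morph klift : x y / x + y}.
Proof.
elim/kcls_ind => s; elim/kcls_ind => t.
by have -> : kcls s + kcls t = kcls (KAdd s t); rewrite ?klift_kcls // -kaddE.
Qed.
Lemma klift0 : klift 0 = 0. Proof. exact: klift_kcls. Qed.
Lemma kliftN : {morph klift : x / - x}.
Proof. by move=> x; apply: (addIr (klift x)); rewrite -kliftD !addNr klift0. Qed.
End KLift.

Lemma cls_zero : cls mzero = 0.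
Proof.
have /cls_ses H : ses mzero mzero mzero by apply: (@ses_cast _ _ erefl) => *;
  rewrite castmx_id.
by apply: (addIr (cls mzero)); rewrite add0r -H.
Qed.

Lemma cls_cast M N (e : mdim M = mdim N) :
  castmx (e, e) (act M (Aa F m)) = act N (Aa F m) ->
  (forall b, castmx (e, e) (act M (As F m b)) = act N (As F m b)) ->
  cls M = cls N.
Proof.
by move=> Ha Hs; have /cls_ses -> := ses_cast Ha Hs; rewrite cls_zero addr0.
Qed.

(* The biadditive extension of [M] [N] = [M (x) N]. *)
Definition kmulr (N : amod) : K0 -> K0 := klift (fun M => cls (mtens M N)).
Definition kmul (x y : K0) : K0 := klift (fun N => kmulr N x) y.

Fact kmulr_ses N L M P : ses L M P ->
  cls (mtens M N) = cls (mtens L N) + cls (mtens P N).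
Proof. by move=> H; apply/cls_ses/ses_l. Qed.
Lemma kmulr_cls N M : kmulr N (cls M) = cls (mtens M N).
Proof. exact: (klift_cls (@kmulr_ses N)). Qed.
Lemma kmulrD N : {morph kmulr N : x y / x + y}.
Proof. exact: (kliftD (@kmulr_ses N)). Qed.
Lemma kmulr0 N : kmulr N 0 = 0.
Proof. exact: (klift0 (@kmulr_ses N)). Qed.
Lemma kmulrN N : {morph kmulr N : x / - x}.
Proof. exact: (kliftN (@kmulr_ses N)). Qed.
Fact kmul_ses x L M P : ses L M P -> kmulr M x = kmulr L x + kmulr P x.
Proof.
move=> H; elim/K0_ind: x => [N||x y Hx Hy|x Hx].
- by rewrite !kmulr_cls; apply/cls_ses/ses_r.
- by rewrite !kmulr0 addr0.
- by rewrite !kmulrD Hx Hy addrACA.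
- by rewrite !kmulrN Hx opprD.
Qed.

Fact kmulDr : right_distributive kmul +%R.
Proof. by move=> x y z; rewrite /kmul (kliftD (@kmul_ses x)). Qed.
Lemma kmul0r x : kmul x 0 = 0. Proof. exact: (klift0 (@kmul_ses x)). Qed.
Lemma kmulNr x y : kmul x (- y) = - kmul x y.
Proof. exact: (kliftN (@kmul_ses x)). Qed.
Lemma kmul_clsr x N : kmul x (cls N) = kmulr N x.
Proof. exact: (klift_cls (@kmul_ses x)). Qed.
Lemma kmul_cls M N : kmul (cls M) (cls N) = cls (mtens M N).
Proof. by rewrite kmul_clsr kmulr_cls. Qed.
Fact kmulDl : left_distributive kmul +%R.
Proof.
move=> x y z; elim/K0_ind: z => [N||u v Hu Hv|u Hu].
- by rewrite !kmul_clsr kmulrD.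
- by rewrite !kmul0r addr0.
- by rewrite !kmulDr Hu Hv addrACA.
- by rewrite !kmulNr Hu opprD.
Qed.
Lemma kmul0l x : kmul 0 x = 0.
Proof. by apply: (addIr (kmul 0 x)); rewrite -kmulDl !add0r. Qed.
Lemma kmulNl x y : kmul (- x) y = - kmul x y.
Proof. by apply: (addIr (kmul x y)); rewrite -kmulDl !addNr kmul0l. Qed.

Lemma Ae_act M k : act M (Ae F m k) =
  2^-1 *: (1%:M + (if k then - act M (Aa F m) else act M (Aa F m))).
Proof.
rewrite /Ae ahomM ahom_cst ahomD ahom1 -mulmxE mul_scalar_mx.
by case: k; rewrite ?ahomN.
Qed.

Lemma act_eD M : act M (Ae F m false) + act M (Ae F m true) = 1%:M.
Proof. by rewrite -ahomD AeD ahom1. Qed.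

Fact kmul_unitl M : cls (mtens munit M) = cls M.
Proof.
apply: (@cls_cast (mtens munit M) M (mul1n _)) => [|b].
  rewrite mtens_a munit_act A4_lift_a tens_scalar_mx scale1r.
  by rewrite castmx_comp castmx_id.
have H c : act munit (As F m c) = 1%:M by rewrite munit_act A4_lift_s.
rewrite mtens_s !H -tensmxDr -mulmxDl act_eD mul1mx tens_scalar_mx scale1r.
by rewrite castmx_comp castmx_id.
Qed.

Fact kmul_unitr M : cls (mtens M munit) = cls M.
Proof.
apply: (@cls_cast (mtens M munit) M (muln1 _)) => [|b].
  rewrite mtens_a munit_act A4_lift_a tens_mx_scalar scale1r.
  by rewrite castmx_comp castmx_id.
have Ha : act munit (Aa F m) = 1%:M by rewrite munit_act A4_lift_a.
have Hs c : act munit (As F m c) = 1%:M by rewrite munit_act A4_lift_s.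
have H1 : act munit (Ae F m true) = 0 by rewrite Ae_act Ha subrr scaler0.
have H0 : act munit (Ae F m false) = 1%:M by rewrite -(act_eD munit) H1 addr0.
rewrite mtens_s Hs H0 H1 mul1mx mul0mx tensmx0 addr0 tens_mx_scalar scale1r.
by rewrite castmx_comp castmx_id.
Qed.

Lemma mtens_e M N k : act (mtens M N) (Ae F m k) =
  act M (Ae F m false) *t act N (Ae F m k) +
  act M (Ae F m true) *t act N (Ae F m (~~ k)).
Proof.
rewrite !Ae_act mtens_a -(tensmx_cst _ _ 1).
case: k; apply/matrixP => i j; rewrite !mxE;
  move: (1 *+ (_ == _)) (1 *+ (_ == _)) (act M _ _ _) (act N _ _ _) => x y z w; by field.
Qed.

Lemma castmxD n k (e : (n = k) * (n = k)) (B C : 'M[F]_n) :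
  castmx e (B + C) = castmx e B + castmx e C.
Proof. by case: e => e e'; apply/matrixP=> i j; rewrite !(castmxE, mxE). Qed.

Fact kmul_assoc M N P :
  cls (mtens (mtens M N) P) = cls (mtens M (mtens N P)).
Proof.
apply: (@cls_cast (mtens (mtens M N) P) (mtens M (mtens N P))
          (esym (mulnA _ _ _))) => [|b]; first by rewrite !mtens_a tensmxA.
have EE k l (X : 'M_(mdim P)) :
    act P (Ae F m k) *m (act P (Ae F m l) *m X) =
    if k == l then act P (Ae F m k) *m X else 0.
  rewrite mulmxA mulmxE -ahomM AeM.
  by case: eqP => // _; rewrite ahom0 mul0r.
rewrite !mtens_s !mtens_e !(mulmxDl, mulmxDr) !tensmx_mul !EE /= !tensmx0.
rewrite !addr0 !add0r !(tensmxDl, tensmxDr) !castmxD !tensmxA !negbK.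
by rewrite -!addrA; congr (_ + _); rewrite [LHS]addrC [RHS]addrCA -addrA.
Qed.

Fact kmulA : associative kmul.
Proof.
move=> x y z; elim/K0_ind: z => [P||u v Hu Hv|u Hu].
- elim/K0_ind: y => [N||u v Hu Hv|u Hu].
  + elim/K0_ind: x => [M||u v Hu Hv|u Hu].
    * by rewrite !kmul_cls kmul_assoc.
    * by rewrite !kmul0l.
    * by rewrite !kmulDl Hu Hv.
    * by rewrite !kmulNl Hu.
  + by rewrite kmul0l kmul0r kmul0l.
  + by rewrite !(kmulDl, kmulDr) Hu Hv.
  + by rewrite !(kmulNl, kmulNr) Hu.
- by rewrite !kmul0r.
- by rewrite !kmulDr Hu Hv.
- by rewrite !kmulNr Hu.
Qed.
Fact kmul1l : left_id (cls munit) kmul.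
Proof.
move=> x; elim/K0_ind: x => [M||u v Hu Hv|u Hu].
- by rewrite kmul_cls kmul_unitl.
- by rewrite kmul0r.
- by rewrite kmulDr Hu Hv.
- by rewrite kmulNr Hu.
Qed.
Fact kmul1r : right_id (cls munit) kmul.
Proof.
move=> x; elim/K0_ind: x => [M||u v Hu Hv|u Hu].
- by rewrite kmul_cls kmul_unitr.
- by rewrite kmul0l.
- by rewrite kmulDl Hu Hv.
- by rewrite kmulNl Hu.
Qed.

HB.instance Definition _ :=
  GRing.Zmodule_isPzRing.Build K0 kmulA kmul1l kmul1r kmulDl kmulDr.

Lemma clsM M N : cls M * cls N = cls (mtens M N).
Proof. exact: kmul_cls. Qed.

End Modules.

Section Decompositions.
Variables (F : numFieldType) (m : nat).
Local Notation amod := (amod F m).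

Definition submodule (M : amod) (W : {vspace 'cV[F]_(mdim M)}) : Prop :=
  forall (h : A4m F m) (v : 'cV[F]_(mdim M)), v \in W -> act M h *m v \in W.

(* The vectors b are an ordered basis of a submodule of M, on which the       *)
(* generators act as they act on the standard basis of P.                     *)
Definition realizes (M P : amod) (b : seq 'cV[F]_(mdim M)) : Prop :=
  [/\ submodule <<b>>%VS, free b, size b = mdim P &
      forall (g : a4gen) (l : 'I_(mdim P)),
        act M (Ag F m g) *m b`_l = \sum_(k < mdim P) act P (Ag F m g) k l *: b`_k].

Definition decomp1 (M P : amod) (b : seq 'cV[F]_(mdim M)) : Prop :=
  @realizes M P b /\ <<b>>%VS = fullv.

Definition decomp2 (M P : amod) (b : seq 'cV[F]_(mdim M))
    (Q : amod) (c : seq 'cV[F]_(mdim M)) : Prop :=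
  [/\ @realizes M P b, @realizes M Q c, directv (<<b>> + <<c>>)%VS &
      (<<b>> + <<c>>)%VS = fullv].

(* M (x) N = P(b), as modules and in K_0. *)
Definition fusion1 (M N P : amod) (b : seq 'cV[F]_(mdim (mtens M N))) : Prop :=
  @decomp1 (mtens M N) P b /\ cls M * cls N = cls P.

(* M (x) N = P(b) (+) Q(c), as modules and in K_0. *)
Definition fusion2 (M N P : amod) (b : seq 'cV[F]_(mdim (mtens M N)))
    (Q : amod) (c : seq 'cV[F]_(mdim (mtens M N))) : Prop :=
  @decomp2 (mtens M N) P b Q c /\ cls M * cls N = cls P + cls Q.
End Decompositions.

Arguments realizes {F m} M P b.
Arguments decomp1 {F m} M P b.
Arguments decomp2 {F m} M P b Q c.
Arguments fusion1 {F m} M N P b.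
Arguments fusion2 {F m} M N P b Q c.

Definition vtens (F : fieldType) (n k : nat)
  (x : 'cV[F]_n) (y : 'cV[F]_k) : 'cV[F]_(n * k) := x *t y.
Notation "x \otv y" := (vtens x y) (at level 40, left associativity).

Section NamedModules.
Variables (R : realType) (m : nat).
Local Notation C := R[i].
Local Open Scope complex_scope.

Definition lambda : C := cos (2 * pi / m%:R) +i* sin (2 * pi / m%:R).

Lemma lambda_neq0 : lambda != 0.
Proof.
apply/eqP => -[c0 s0]; have := cos2Dsin2 (2 * pi / m%:R : R).
by rewrite c0 s0 expr0n addr0 => /eqP; rewrite eq_sym oner_eq0.
Qed.

Lemma lambda_expm : lambda ^+ m = 1.
Proof.
have H (x : R) n : (cos x +i* sin x) ^+ n = cos (n%:R * x) +i* sin (n%:R * x).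
  elim: n => [|n IH]; first by rewrite expr0 mul0r cos0 sin0.
  rewrite exprS IH -natr1 mulrDl mul1r [_ + x]addrC cosD sinD.
  by apply/eqP; rewrite eq_complex /= eqxx /= addrC.
rewrite H; case: (posnP m) => [->|m0]; first by rewrite mul0r cos0 sin0.
by rewrite mulrC divfK ?pnatr_eq0 -?lt0n // mulr_natl cos2pi sin2pi.
Qed.

Definition sgn (b : bool) : C := (-1) ^+ b.

Lemma sgnM b : sgn b * sgn b = 1.
Proof. by rewrite /sgn -expr2 sqrr_sign. Qed.

(* The map u |-> c v, v |-> c^-1 u. *)
Definition swap (c : C) : 'M[C]_2 :=
  \matrix_(j, k) if j == k then 0 else if k == 0 then c else c^-1.

Lemma swapM c d : swap c *m swap d =
  \matrix_(j, k) if j == k then if k == 0 then c^-1 * d else c * d^-1 else 0.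
Proof.
apply/matrixP => j k; rewrite !mxE big_ord_recl big_ord1 !mxE.
by case: j k => [[|[|//]] ?] [[|[|//]] ?]; rewrite /= ?(mul0r, mulr0, add0r, addr0).
Qed.

Section Pi.
Variables (i : nat) (e : bool).
Let s (b : bool) : 'M[C]_2 := swap (if b then lambda ^+ i else 1).
Fact pi_aa : (sgn e)%:M *m (sgn e)%:M = 1%:M :> 'M[C]_2.
Proof. by rewrite -scalar_mxM sgnM. Qed.
Fact pi_as b : (sgn e)%:M *m s b = s b *m (sgn e)%:M.
Proof. exact/esym/scalar_mxC. Qed.
Fact pi_ss b : s b *m s b = 1%:M.
Proof.
have c0 : (if b then lambda ^+ i else 1) != 0.
  by case: b; rewrite ?oner_eq0 // expf_neq0 // lambda_neq0.
apply/matrixP => j k; rewrite swapM !mxE mulVf // mulfV //.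
by case: (k == 0); case: (j == k).
Qed.
Fact pi_dih : (s false *m s true) ^+ m = 1%:M.
Proof.
have H n : (s false *m s true) ^+ n = \matrix_(j, k)
   if j == k then if k == 0 then (lambda ^+ i) ^+ n else (lambda ^+ i) ^- n else 0.
  elim: n => [|n IH]; first by
    apply/matrixP => j k; rewrite expr0 !mxE expr0 invr1; case: (k == 0); case: (j == k).
  rewrite exprS IH -mulmxE swapM; apply/matrixP => j k.
  rewrite !mxE big_ord_recl big_ord1 !mxE invr1 !mul1r !exprS invfM.
  by case: j k => [[|[|//]] ?] [[|[|//]] ?];
    rewrite /= ?(mul0r, mulr0, add0r, addr0).
rewrite H; apply/matrixP => j k; rewrite !mxE exprAC lambda_expm expr1n invr1.
by case: (k == 0); case: (j == k).
Qed.
(* pi_i^e(u, v), where u, v is the standard basis. *)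
Definition pimod : amod C m := mkmod pi_aa pi_as pi_ss pi_dih.
End Pi.

Section T.
Variables (al e : bool).
Fact T_sgn b : (sgn b)%:M *m (sgn b)%:M = 1%:M :> 'M[C]_1.
Proof. by rewrite -scalar_mxM sgnM. Qed.
Fact T_as (b : bool) :
  (sgn e)%:M *m (sgn al)%:M = (sgn al)%:M *m (sgn e)%:M :> 'M[C]_1.
Proof. exact/esym/scalar_mxC. Qed.
Fact T_dih : ((sgn al)%:M *m (sgn al)%:M : 'M[C]_1) ^+ m = 1%:M.
Proof. by rewrite T_sgn expr1n. Qed.
(* T_{al, al, e}: the elements s_+ and s_- act by al, and a acts by e. *)
Definition Tmod : amod C m :=
  @mkmod C m 1 (sgn e)%:M (fun=> (sgn al)%:M) (T_sgn e) T_as (fun=> T_sgn al) T_dih.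
End T.

Definition uvec : 'cV[C]_2 := delta_mx 0 0.
Definition vvec : 'cV[C]_2 := delta_mx 1 0.
Definition tvec : 'cV[C]_1 := delta_mx 0 0.

Lemma Tmod_t al e : [/\
  forall b, act (Tmod al e) (As C m b) *m tvec = sgn al *: tvec &
  act (Tmod al e) (Aa C m) *m tvec = sgn e *: tvec].
Proof. by split=> *; rewrite ?mkmod_s ?mkmod_a mul_scalar_mx. Qed.

Lemma pimod_u i e : [/\
  act (pimod i e) (As C m false) *m uvec = vvec,
  act (pimod i e) (As C m true) *m uvec = lambda ^+ i *: vvec &
  act (pimod i e) (Aa C m) *m uvec = sgn e *: uvec].
Proof.
split; rewrite ?mkmod_s ?mkmod_a ?mul_scalar_mx //; apply/colP => k;
  rewrite !mxE big_ord_recl big_ord1 !mxE;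
  by case: k => [[|[|//]] ?]; rewrite /= ?(mul0r, mulr0, mulr1, add0r, addr0).
Qed.

Lemma pimod_v i e : [/\
  act (pimod i e) (As C m false) *m vvec = uvec,
  act (pimod i e) (As C m true) *m vvec = lambda ^- i *: uvec &
  act (pimod i e) (Aa C m) *m vvec = sgn e *: vvec].
Proof.
split; rewrite ?mkmod_s ?mkmod_a ?mul_scalar_mx //; apply/colP => k;
  rewrite !mxE big_ord_recl big_ord1 !mxE;
  by case: k => [[|[|//]] ?];
     rewrite /= ?(invr1, mul0r, mulr0, mulr1, add0r, addr0).
Qed.
End NamedModules.

(* Main.v *)
Require Import Defs.
From mathcomp Require Import all_boot all_order all_algebra.
From mathcomp Require Import complex reals mxtens zify.
Local Open Scope ring_scope.
Set Implicit Arguments.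
Unset Strict Implicit.
Unset Printing Implicit Defensive.
Import GRing.Theory Num.Theory.

(** Every module in the statement has [a] acting by a sign, so on a tensor
    product [M (x) N] one of the idempotents [e_0], [e_1] acts on [N] by the
    identity and the other by zero.  The coproduct then collapses to a single
    term: [s_+] and [s_-] act by [s_+ (x) s_+] and [s_- (x) s_-] when [a] acts
    on [N] by 1, and by [s_- (x) s_+] and [s_+ (x) s_-] when [a] acts on [N]
    by -1 ([mtens_s_vtens]).

    It follows that the generators permute the tensors of basis vectors up to
    scalars, and the whole theorem is about reading off 2-cycles.  A free pair
    [w, w'] with [s_+ w = w'], [s_- w = c w'] and [a w = e w] ([swap_pair])
    spans a copy of [pi_k^e] as soon as [c = lambda^k]: the action on [w'] is
    forced because the [s_b] are involutions commuting with [a].  For the same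
    reason [w', w] is such a pair with [c^-1] in place of [c].  Tensoring two
    two-dimensional modules produces one pair with [c = lambda^i / lambda^j]
    and one with [c = lambda^i lambda^j].  The four cases of each fusion rule
    only choose, by swapping the pairs if needed, an exponent in the range
    [0 .. (m-1)/2] that represents [c]; in the last two this uses
    [lambda^m = 1] ([pi_fusion2_cases]).

    The vectors displayed in a rule are nonzero multiples of all the tensors of
    basis vectors, hence span; a spanning family of the right size is free,
    which makes the sum direct ([decomp2_span]).  Finally a direct sum
    decomposition gives a split exact sequence, which is the equality in the
    Grothendieck ring ([decomp2_cls]). *)

(** * Vectors as columns of a matrix *)

Section Columns.
Variables (F : fieldType) (n : nat).
Implicit Types (b c : seq 'cV[F]_n) (v : 'cV[F]_n).

Definition cols_mx p b : 'M[F]_(n, p) := \matrix_(r, k) b`_k r 0.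

Lemma cols_mxE p b (x : 'cV[F]_p) :
  cols_mx p b *m x = \sum_k x k 0 *: b`_k.
Proof.
apply/colP => r; rewrite mxE summxE; apply: eq_bigr => k _.
by rewrite !mxE mulrC.
Qed.

Lemma span_cols_mx p b v : size b = p -> v \in <<b>>%VS ->
  exists x : 'cV_p, cols_mx p b *m x = v.
Proof.
move=> <- vb; exists (\col_k coord (in_tuple b) k v).
rewrite cols_mxE [RHS](coord_span (vb : v \in <<in_tuple b>>%VS)).
by apply: eq_bigr => k _; rewrite mxE.
Qed.

(** Allows a one-sided inverse to be used on both sides for matrices that are
    square only up to a propositional equality of dimensions. *)
Lemma left_inverse_mx k (A : 'M[F]_(n, k)) (B : 'M_(k, n)) :
  n = k -> A *m B = 1%:M -> B *m A = 1%:M.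
Proof. by move=> e; subst k; apply: mulmx1C. Qed.

Lemma free_full_size b : <<b>>%VS = fullv -> free b = (size b == n).
Proof. by rewrite /free eq_sym => ->; rewrite dimvf dim_matrix mulr1. Qed.

Lemma mem_span_scale b (c : F) v :
  c != 0 -> c *: v \in b -> v \in <<b>>%VS.
Proof. by move=> /negPf c0 /memv_span; rewrite rpredZeq c0. Qed.

Lemma full_delta (W : {vspace 'cV[F]_n}) :
  (forall k, delta_mx k 0 \in W) -> W = fullv.
Proof.
move=> HW; apply/vspaceP => v; rewrite memvf [v]matrix_sum_delta.
by apply: rpred_sum => k _; rewrite big_ord1; apply/rpredZ/HW.
Qed.
End Columns.

(** * Submodules given by ordered bases *)

Section Realizations.
Variables (F : numFieldType) (m : nat).
Implicit Types M N P Q : amod F m.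

Definition acts_as M P (b : seq 'cV[F]_(mdim M)) : Prop :=
  forall (g : a4gen) (l : 'I_(mdim P)),
    act M (Ag F m g) *m b`_l = \sum_(k < mdim P) act P (Ag F m g) k l *: b`_k.

Lemma submodule_gen M (W : {vspace 'cV[F]_(mdim M)}) :
  (forall g v, v \in W -> act M (Ag F m g) *m v \in W) -> submodule W.
Proof.
rewrite /submodule => HW; elim/presalg_ind => [//|c|x y Hx Hy|x y Hx Hy]
  v vW.
- by rewrite ahom_cst mul_scalar_mx rpredZ.
- by rewrite ahomD mulmxDl rpredD ?Hx ?Hy.
- by rewrite ahomM -mulmxE -mulmxA Hx ?Hy.
Qed.

Lemma realizes_gen M P (b : seq 'cV[F]_(mdim M)) :
  size b = mdim P -> free b -> acts_as P b -> realizes M P b.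
Proof.
move=> sb fb Hb; split=> //; apply: submodule_gen => g v vb.
have [x <-] := span_cols_mx sb vb.
rewrite cols_mxE mulmx_sumr rpred_sum // => l _.
rewrite -scalemxAr rpredZ // Hb rpred_sum // => k _.
by rewrite rpredZ // memv_span // mem_nth // sb.
Qed.

(** Freeness of both families and directness of the sum all come from one
    dimension count on the concatenated family. *)
Lemma decomp2_span M P Q (b c : seq 'cV[F]_(mdim M)) :
  size b = mdim P -> size c = mdim Q -> (mdim P + mdim Q)%N = mdim M ->
  <<b ++ c>>%VS = fullv -> acts_as P b -> acts_as Q c -> decomp2 M P b Q c.
Proof.
move=> sb sc dM full Hb Hc.
have := free_full_size full; rewrite size_cat sb sc dM eqxx cat_free.
move=> /and3P[fb fc dbc]; split=> //; try exact: realizes_gen.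
by rewrite -span_cat.
Qed.

Lemma cols_mx_intertwines M P (b : seq 'cV[F]_(mdim M)) :
  acts_as P b -> intertwines (M := P) (N := M) (cols_mx (mdim P) b).
Proof.
move=> Hb h; apply: intertwines_gen h => g; apply: col_eqP => l.
rewrite !colE -!mulmxA -[act P _ *m _]colE cols_mxE.
have -> : cols_mx (mdim P) b *m delta_mx l 0 = b`_l.
  by rewrite -colE; apply/colP => r; rewrite !mxE.
by rewrite Hb; apply: eq_bigr => k _; rewrite mxE.
Qed.

(** The two bases, written as matrices [i] and [f], give module maps from [P]
    and [Q] to [M], and [(i f)] is invertible.  The lower block of its inverse
    is the projection that completes [i] to an exact sequence
    [0 -> P -> M -> Q -> 0] split by [f]. *)
Lemma decomp2_cls M P Q (b c : seq 'cV[F]_(mdim M)) :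
  decomp2 M P b Q c -> cls M = cls P + cls Q.
Proof.
case=> -[_ fb sb Hb] [_ fc sc Hc] dbc full; apply: cls_ses.
set i := cols_mx (mdim P) b; set f := cols_mx (mdim Q) c.
have Hi : intertwines (M := P) (N := M) i := cols_mx_intertwines Hb.
have Hf : intertwines (M := Q) (N := M) f := cols_mx_intertwines Hc.
have [B AB] : exists B, row_mx i f *m B = 1%:M.
  apply: mulmx_solve => j; set v := col j _.
  have /memv_addP[v1 /(span_cols_mx sb)[x <-] [v2 /(span_cols_mx sc)[y <-] ->]] :
    v \in (<<b>> + <<c>>)%VS by rewrite full memvf.
  by exists (col_mx x y); rewrite mul_row_col.
have dM : mdim M = (mdim P + mdim Q)%N.
  have fbc : free (b ++ c) by rewrite cat_free fb fc.
  move: fbc; rewrite free_full_size ?span_cat // size_cat sb sc.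
  by move/eqP.
have := left_inverse_mx dM AB; move: AB; rewrite -[B]vsubmxK.
set r := usubmx B; set p := dsubmx B.
rewrite mul_row_col mul_col_row scalar_mx_block => AB /eq_block_mx[ri rf pi pf].
apply: (split_ses (i := i) (p := p) (r := r) (s := f)) => // h.
(* Write [h = h (i r + f p)] and move [h] across [i] and [f]: the first term
   dies by [p i = 0], the second is [h p] by [p f = 1]. *)
rewrite -[act M h]mulmx1 -AB mulmxDr !mulmxA -Hi -Hf.
by rewrite mulmxDr !mulmxA pi pf !mul0mx mul1mx add0r.
Qed.

Lemma decomp1_span M P (b : seq 'cV[F]_(mdim M)) :
  size b = mdim P -> mdim P = mdim M ->
  <<b>>%VS = fullv -> acts_as P b -> decomp1 M P b.
Proof.
move=> sb dM full Hb; split=> //; apply: realizes_gen => //.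
by rewrite free_full_size // sb dM.
Qed.

(** A one-term decomposition is a two-term one whose second term is the zero
    module with the empty basis. *)
Lemma decomp1_cls M P (b : seq 'cV[F]_(mdim M)) :
  decomp1 M P b -> cls M = cls P.
Proof.
case=> Hb full; rewrite -[RHS]addr0 -(cls_zero F m).
apply: (@decomp2_cls _ _ _ b [::]); case: (Hb) => _ fb _ _; split=> //.
- by apply: realizes_gen => [//||g []//]; apply: nil_free.
- by have := fb; rewrite -[X in free X]cats0 cat_free => /and3P[].
- by rewrite span_nil addv0.
Qed.
End Realizations.

(** * Generators acting on tensors *)

Section TensorVectors.
Variable F : fieldType.

Lemma vtensZ n k (c d : F) (x : 'cV[F]_n) (y : 'cV[F]_k) :
  (c *: x) \otv (d *: y) = (c * d) *: (x \otv y).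
Proof. by apply/matrixP => r s; rewrite !mxE mulrACA. Qed.

Lemma vtensZl n k (c : F) (x : 'cV[F]_n) (y : 'cV[F]_k) :
  (c *: x) \otv y = c *: (x \otv y).
Proof. by rewrite -[y in LHS]scale1r vtensZ mulr1. Qed.
Lemma vtensZr n k (c : F) (x : 'cV[F]_n) (y : 'cV[F]_k) :
  x \otv (c *: y) = c *: (x \otv y).
Proof. by rewrite -[x in LHS]scale1r vtensZ mul1r. Qed.

Lemma mul_vtens n k (A : 'M[F]_n) (B : 'M[F]_k) (x : 'cV[F]_n) (y : 'cV[F]_k) :
  (A *t B) *m (x \otv y) = (A *m x) \otv (B *m y).
Proof. exact: (tensmx_mul A B (x : 'M_(n, 1)) (y : 'M_(k, 1))). Qed.

Lemma full_vtens n k (W : {vspace 'cV[F]_(n * k)}) :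
  (forall p q, delta_mx p 0 \otv delta_mx q 0 \in W) -> W = fullv.
Proof.
move=> HW; apply: full_delta => r; case: (mxtens_indexP r) => p q.
suff -> : delta_mx (mxtens_index (p, q)) 0 =
    delta_mx p 0 \otv delta_mx q 0 :> 'cV[F]_(n * k) by [].
apply/colP => s; case: (mxtens_indexP s) => p' q'.
(* The column index of a tensor of columns ranges over a product of two
   one-element types. *)
have -> : 0 = mxtens_index (0, 0) :> 'I_(1 * 1) by apply: val_inj.
apply: etrans (esym (tensmxE (delta_mx p 0 : 'cV_n) (delta_mx q 0 : 'cV_k)
  p' q' 0 0)).
rewrite !mxE (can_eq (@mxtens_indexK n k)) xpair_eqE !eqxx !andbT.
by rewrite -natrM mulnb.
Qed.
End TensorVectors.

Section ScalarA.
Variables (F : numFieldType) (m : nat).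
Implicit Types M N : amod F m.

Lemma Ae_scalar N (d k : bool) : act N (Aa F m) = ((-1) ^+ d)%:M ->
  act N (Ae F m k) = (k == d)%:R%:M.
Proof.
move=> Ha; have two : 2 != 0 :> F by rewrite pnatr_eq0.
rewrite Ae_act Ha; case: k d {Ha} => [] [];
  rewrite /= ?expr0 ?expr1 -?raddfN -?raddfD /= scale_scalar_mx
          ?opprK ?subrr ?mulr0 //.
- by rewrite -[1 + 1]/2 mulVf.
- by rewrite -[1 + 1]/2 mulVf.
Qed.

(** Only the summand of the coproduct whose idempotent acts on [N] by the
    identity survives, so [s_b] acts on the left factor with its sign shifted
    by the sign of [a] on [N]. *)
Lemma mtens_s_vtens M N (d b : bool) (x : 'cV_(mdim M)) (y : 'cV_(mdim N)) :
  act N (Aa F m) = ((-1) ^+ d)%:M ->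
  act (mtens M N) (As F m b) *m (x \otv y) =
  (act M (As F m (d (+) b)) *m x) \otv (act N (As F m b) *m y).
Proof.
move=> Ha; rewrite mtens_s !(Ae_scalar _ Ha) -mul_vtens.
by case: d {Ha};
  rewrite /= ?mul_scalar_mx ?scale0r ?scale1r ?tensmx0 ?addr0 ?add0r.
Qed.

Lemma mtens_a_vtens M N (d e : bool) (x : 'cV_(mdim M)) (y : 'cV_(mdim N)) :
  act M (Aa F m) = ((-1) ^+ e)%:M -> act N (Aa F m) = ((-1) ^+ d)%:M ->
  act (mtens M N) (Aa F m) *m (x \otv y) = (-1) ^+ (e (+) d) *: (x \otv y).
Proof.
move=> Ha Hb.
by rewrite mtens_a mul_vtens Ha Hb !mul_scalar_mx vtensZ signr_addb.
Qed.
End ScalarA.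

(** * Pairs of vectors exchanged by the involutions *)

Section Named.
Variables (R : realType) (m : nat).
Local Notation C := R[i].
Local Notation sp M := (act M (As C m false)).
Local Notation sm M := (act M (As C m true)).
Local Notation pi := (pimod R m).
Local Notation T := (Tmod R m).
Local Notation l := (lambda R m).
Local Notation u := (uvec R).
Local Notation v := (vvec R).
Local Notation t := (tvec R).
Implicit Types (M : amod C m) (e d al : bool) (c : C).

(** Equivalently, [w] is a common eigenvector of [a] and of the rotation
    [s_+ s_-], with eigenvalues the sign [e] and [c], and [w' = s_+ w]. *)
Definition swap_pair M e c (w w' : 'cV[C]_(mdim M)) : Prop :=
  [/\ act M (Aa C m) *m w = sgn R e *: w, sp M *m w = w' & sm M *m w = c *: w'].

Lemma act_ss M b (w : 'cV_(mdim M)) :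
  act M (As C m b) *m (act M (As C m b) *m w) = w.
Proof. by rewrite mulmxA mulmxE -ahomM Ass ahom1 mul1mx. Qed.

(** The action on [w'] follows from that on [w], since each [s_b] is its own
    inverse and commutes with [a]. *)
Lemma swap_pair_sym M e c (w w' : 'cV[C]_(mdim M)) :
  c != 0 -> swap_pair e c w w' -> swap_pair e c^-1 w' w.
Proof.
move=> c0 [Ha Hp Hm]; split.
- by rewrite -Hp mulmxA mulmxE -ahomM Aas ahomM -mulmxE -mulmxA Ha scalemxAr.
- by rewrite -Hp act_ss.
- by rewrite -[w in RHS](act_ss true) Hm -scalemxAr scalerA mulVf // scale1r.
Qed.

Lemma swap_pair_acts M k e (w w' : 'cV[C]_(mdim M)) :
  swap_pair e (l ^+ k) w w' -> acts_as (pi k e) [:: w; w'].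
Proof.
move=> H; have l0 : l ^+ k != 0 by rewrite expf_neq0 // lambda_neq0.
case: (H) (swap_pair_sym l0 H) => [Ha Hp Hm] [Ha' Hp' Hm'] g.
have -> : act (pi k e) (Ag C m g) = match g with Ga => (sgn R e)%:M
    | Gs b => swap (if b then l ^+ k else 1) end.
  by case: g => [|b]; [exact: mkmod_a | exact: mkmod_s].
rewrite -[mdim _]/2%N; case=> [[|[|//]] r]; rewrite big_ord_recl big_ord1 /=;
  by case: g => [|[]];
     rewrite !mxE /= ?mulr1n ?mulr0n ?invr1 ?scale0r ?scale1r ?addr0 ?add0r.
Qed.

Lemma T_acts M al e (w : 'cV[C]_(mdim M)) :
  act M (Aa C m) *m w = sgn R e *: w ->
  (forall b, act M (As C m b) *m w = sgn R al *: w) -> acts_as (T al e) [:: w].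
Proof.
move=> Ha Hs g.
have -> : act (T al e) (Ag C m g) =
    match g with Ga => (sgn R e)%:M | Gs _ => (sgn R al)%:M end.
  by case: g => [|b]; [exact: mkmod_a | exact: mkmod_s].
rewrite -[mdim _]/1%N; case=> [[|//] r]; rewrite big_ord1 /=.
by case: g => [|b]; rewrite mxE /= mulr1n ?Ha // Hs.
Qed.

Lemma pi_a i e : act (pi i e) (Aa C m) = ((-1) ^+ e)%:M.
Proof. exact: mkmod_a. Qed.
Lemma T_a al e : act (T al e) (Aa C m) = ((-1) ^+ e)%:M.
Proof. exact: mkmod_a. Qed.
Lemma T_s al e b : act (T al e) (As C m b) = (sgn R al)%:M.
Proof. exact: mkmod_s. Qed.

(** * Spanning by tensors of basis vectors *)

Lemma uv_cases (p : 'I_2) : delta_mx p 0 = u \/ delta_mx p 0 = v.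
Proof.
by case: p => [[|[|//]] p]; [left|right]; congr delta_mx; apply: val_inj.
Qed.

Lemma delta_t (p : 'I_1) : delta_mx p 0 = t.
Proof. by rewrite ord1. Qed.

Lemma full_pi_pi (W : {vspace 'cV[C]_(2 * 2)}) c : c != 0 ->
  u \otv u \in W -> u \otv v \in W ->
  c *: (v \otv u) \in W -> c *: (v \otv v) \in W -> W = fullv.
Proof.
move=> /negPf c0 uu uv; rewrite !rpredZeq c0 /= => vu vv.
by apply: full_vtens => p q; case: (uv_cases p) (uv_cases q) => -> [] ->.
Qed.

Lemma full_T_pi (W : {vspace 'cV[C]_(1 * 2)}) :
  t \otv u \in W -> t \otv v \in W -> W = fullv.
Proof.
move=> tu tv; apply: full_vtens => p q.
by rewrite delta_t; case: (uv_cases q) => ->.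
Qed.

Lemma full_pi_T (W : {vspace 'cV[C]_(2 * 1)}) :
  u \otv t \in W -> v \otv t \in W -> W = fullv.
Proof.
move=> ut vt; apply: full_vtens => p q.
by rewrite delta_t; case: (uv_cases p) => ->.
Qed.

(** * Products of two-dimensional modules *)

Lemma pi_pi_diag i j e : @swap_pair (mtens (pi i e) (pi j false)) e
  (l ^+ i * l ^+ j) (u \otv u) (v \otv v).
Proof.
have [iup ium _] := pimod_u R m i e; have [jup jum _] := pimod_u R m j false.
split; rewrite ?(mtens_a_vtens _ _ (pi_a _ _) (pi_a _ _)) ?addbF //.
  by rewrite (mtens_s_vtens _ _ _ (pi_a _ _)) iup jup.
by rewrite (mtens_s_vtens _ _ _ (pi_a _ _)) ium jum vtensZ.
Qed.

Lemma pi_pi_antidiag i j e : @swap_pair (mtens (pi i e) (pi j false)) e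
  (l ^+ i / l ^+ j) (u \otv v) (v \otv u).
Proof.
have [iup ium _] := pimod_u R m i e; have [jvp jvm _] := pimod_v R m j false.
split; rewrite ?(mtens_a_vtens _ _ (pi_a _ _) (pi_a _ _)) ?addbF //.
  by rewrite (mtens_s_vtens _ _ _ (pi_a _ _)) iup jvp.
by rewrite (mtens_s_vtens _ _ _ (pi_a _ _)) ium jvm vtensZ.
Qed.

Lemma lX_neq0 k : l ^+ k != 0.
Proof. by rewrite expf_neq0 // lambda_neq0. Qed.

(** When [a] acts on the right factor by -1, [s_+] acts as [s_- (x) s_+] and
    sends [v (x) v] and [v (x) u] to [lambda^-i] times [u (x) u] and [u (x) v];
    the factor [lambda^i] in the bases cancels this, so that [s_+] maps each
    basis vector to the other. *)
Lemma pi_pi_twisted_antidiag i j e :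
  @swap_pair (mtens (pi i e) (pi j true)) (~~ e)
  (l ^+ i * l ^+ j) (l ^+ i *: (v \otv u)) (u \otv v).
Proof.
have [ivp ivm _] := pimod_v R m i e; have [jup jum _] := pimod_u R m j true.
split; rewrite -scalemxAr.
- by rewrite (mtens_a_vtens _ _ (pi_a _ _) (pi_a _ _)) addbT !scalerA mulrC.
- rewrite (mtens_s_vtens _ _ _ (pi_a _ _)) ivm jup vtensZl scalerA.
  by rewrite mulfV ?lX_neq0 ?scale1r.
- by rewrite (mtens_s_vtens _ _ _ (pi_a _ _)) ivp jum vtensZr scalerA.
Qed.

Lemma pi_pi_twisted_diag i j e :
  @swap_pair (mtens (pi i e) (pi j true)) (~~ e)
  (l ^+ i / l ^+ j) (l ^+ i *: (v \otv v)) (u \otv u).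
Proof.
have [ivp ivm _] := pimod_v R m i e; have [jvp jvm _] := pimod_v R m j true.
split; rewrite -scalemxAr.
- by rewrite (mtens_a_vtens _ _ (pi_a _ _) (pi_a _ _)) addbT !scalerA mulrC.
- rewrite (mtens_s_vtens _ _ _ (pi_a _ _)) ivm jvp vtensZl scalerA.
  by rewrite mulfV ?lX_neq0 ?scale1r.
- by rewrite (mtens_s_vtens _ _ _ (pi_a _ _)) ivp jvm vtensZr scalerA.
Qed.

Section PiPi.
Variables (i j : nat) (e d : bool).
Let M := mtens (pi i e) (pi j d).

Lemma pi_fusion2 k k' e' (w1 w2 w3 w4 : 'cV[C]_(mdim M)) :
  swap_pair e' (l ^+ k) w1 w2 -> swap_pair e' (l ^+ k') w3 w4 ->
  <<[:: w1; w2; w3; w4]>>%VS = fullv ->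
  fusion2 (pi i e) (pi j d) (pi k e') [:: w1; w2] (pi k' e') [:: w3; w4].
Proof.
move=> H H' full.
suff D : decomp2 M (pi k e') [:: w1; w2] (pi k' e') [:: w3; w4].
  by split=> //; rewrite clsM; apply: decomp2_cls D.
by apply: decomp2_span => //; apply: swap_pair_acts.
Qed.

(** The multipliers [lambda^i / lambda^j] and [lambda^i lambda^j] determine the
    exponents modulo [m] only; swapping a pair negates its exponent. *)
Lemma pi_fusion2_cases h e' (w1 w2 w3 w4 : 'cV[C]_(mdim M)) :
  (i + j <= m)%N ->
  swap_pair e' (l ^+ i / l ^+ j) w1 w2 ->
  swap_pair e' (l ^+ i * l ^+ j) w3 w4 ->
  <<[:: w1; w2; w3; w4]>>%VS = fullv ->
  [/\ (i + j <= h)%N -> (j <= i)%N -> fusion2 (pi i e) (pi j d)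
        (pi (i - j)%N e') [:: w1; w2] (pi (i + j)%N e') [:: w3; w4],
      (i + j <= h)%N -> (i <= j)%N -> fusion2 (pi i e) (pi j d)
        (pi (j - i)%N e') [:: w2; w1] (pi (i + j)%N e') [:: w3; w4],
      (h < i + j)%N -> (j <= i)%N -> fusion2 (pi i e) (pi j d)
        (pi (i - j)%N e') [:: w1; w2] (pi (m - i - j)%N e') [:: w4; w3] &
      (h < i + j)%N -> (i <= j)%N -> fusion2 (pi i e) (pi j d)
        (pi (j - i)%N e') [:: w2; w1] (pi (m - i - j)%N e') [:: w4; w3]].
Proof.
move=> le_m Hdiff Hsum full.
have U : l \is a GRing.unit by rewrite unitfE lambda_neq0.
have Hd : (j <= i)%N -> swap_pair e' (l ^+ (i - j)) w1 w2.
  by move=> ?; rewrite exprB.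
have Hd' : (i <= j)%N -> swap_pair e' (l ^+ (j - i)) w2 w1.
  move=> ?; rewrite exprB // -invf_div; apply: swap_pair_sym Hdiff.
  by rewrite mulf_neq0 ?invr_neq0 ?lX_neq0.
have Hs : swap_pair e' (l ^+ (i + j)) w3 w4 by rewrite exprD.
have Hs' : swap_pair e' (l ^+ (m - i - j)) w4 w3.
  rewrite -subnDA exprB // lambda_expm div1r exprD.
  by apply: swap_pair_sym Hsum; rewrite mulf_neq0 ?lX_neq0.
split=> _ le_ij; apply: pi_fusion2; auto; rewrite -full;
  by apply: eq_span => z; rewrite !inE; do 4!case: eqP.
Qed.
End PiPi.

(** * Products with one-dimensional modules *)

Lemma sgn_neq0 al : sgn R al != 0.
Proof. by rewrite /sgn signr_eq0. Qed.

Lemma pi_fusion1 (M N : amod C m) k e (w w' : 'cV[C]_(mdim (mtens M N))) :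
  mdim (mtens M N) = 2 -> swap_pair e (l ^+ k) w w' ->
  <<[:: w; w']>>%VS = fullv ->
  fusion1 M N (pi k e) [:: w; w'].
Proof.
move=> dM H full; suff D : decomp1 (mtens M N) (pi k e) [:: w; w'].
  by split=> //; rewrite clsM; apply: decomp1_cls D.
by apply: decomp1_span => //; apply: swap_pair_acts.
Qed.

Lemma T_pi_pair al e i d : @swap_pair (mtens (T al e) (pi i d)) (e (+) d)
  (l ^+ i) (t \otv u) (sgn R al *: (t \otv v)).
Proof.
have [up um _] := pimod_u R m i d.
split; first by rewrite (mtens_a_vtens _ _ (T_a _ _) (pi_a _ _)).
- by rewrite (mtens_s_vtens _ _ _ (pi_a _ _)) up T_s mul_scalar_mx vtensZl.
- rewrite (mtens_s_vtens _ _ _ (pi_a _ _)) um T_s mul_scalar_mx vtensZ.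
  by rewrite scalerA mulrC.
Qed.

Lemma pi_T_pair i d al : @swap_pair (mtens (pi i d) (T al false)) d
  (l ^+ i) (u \otv t) (sgn R al *: (v \otv t)).
Proof.
have [up um _] := pimod_u R m i d.
split; first by rewrite (mtens_a_vtens _ _ (pi_a _ _) (T_a _ _)) addbF.
- by rewrite (mtens_s_vtens _ _ _ (T_a _ _)) up T_s mul_scalar_mx vtensZr.
- rewrite (mtens_s_vtens _ _ _ (T_a _ _)) um T_s mul_scalar_mx vtensZ.
  by rewrite scalerA.
Qed.

Lemma pi_T_twisted_pair i d al : @swap_pair (mtens (pi i d) (T al true)) (~~ d)
  (l ^+ i) (l ^+ i *: (v \otv t)) (sgn R al *: (u \otv t)).
Proof.
have [vp vm _] := pimod_v R m i d.
split; rewrite -scalemxAr.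
- by rewrite (mtens_a_vtens _ _ (pi_a _ _) (T_a _ _)) addbT !scalerA mulrC.
- rewrite (mtens_s_vtens _ _ _ (T_a _ _)) vm T_s mul_scalar_mx vtensZ scalerA.
  by rewrite mulrA mulfV ?lX_neq0 ?mul1r.
- by rewrite (mtens_s_vtens _ _ _ (T_a _ _)) vp T_s mul_scalar_mx vtensZr.
Qed.

Lemma T_T_fusion al e be d :
  fusion1 (T al e) (T be d) (T (al (+) be) (e (+) d)) [:: t \otv t].
Proof.
suff D : decomp1 (mtens (T al e) (T be d)) (T (al (+) be) (e (+) d))
    [:: t \otv t].
  by split=> //; rewrite clsM; apply: decomp1_cls D.
apply: decomp1_span => //.
  by apply: full_vtens => p q; rewrite !delta_t memv_span ?mem_head.
apply: T_acts => [|b]; first by rewrite (mtens_a_vtens _ _ (T_a _ _) (T_a _ _)).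
rewrite (mtens_s_vtens _ _ _ (T_a _ _)) !T_s !mul_scalar_mx vtensZ.
by rewrite /sgn signr_addb.
Qed.

End Named.

(** * The fusion rules *)

Theorem theorem5p3 (R : realType) (m : nat) (m_ge2 : (2 <= m)%N) (m_odd : odd m) :
  let h := (m.-1)./2 in
  let l := lambda R m in
  let u := uvec R in let v := vvec R in
  let x := uvec R in let y := vvec R in
  let t := tvec R in let s := tvec R in
  let Pi := pimod R m in
  let T := Tmod R m in
  (forall (i j : nat) (e : bool), (1 <= i <= h)%N -> (1 <= j <= h)%N ->
    [/\ (i + j <= h)%N -> (j <= i)%N ->
          fusion2 (Pi i e) (Pi j false)
            (Pi (i - j)%N e) [:: u \otv y; v \otv x]
            (Pi (i + j)%N e) [:: u \otv x; v \otv y],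
        (i + j <= h)%N -> (i <= j)%N ->
          fusion2 (Pi i e) (Pi j false)
            (Pi (j - i)%N e) [:: v \otv x; u \otv y]
            (Pi (i + j)%N e) [:: u \otv x; v \otv y],
        (h < i + j)%N -> (j <= i)%N ->
          fusion2 (Pi i e) (Pi j false)
            (Pi (i - j)%N e) [:: u \otv y; v \otv x]
            (Pi (m - i - j)%N e) [:: v \otv y; u \otv x] &
        (h < i + j)%N -> (i <= j)%N ->
          fusion2 (Pi i e) (Pi j false)
            (Pi (j - i)%N e) [:: v \otv x; u \otv y]
            (Pi (m - i - j)%N e) [:: v \otv y; u \otv x]]) /\
  (forall (i j : nat) (e : bool), (1 <= i <= h)%N -> (1 <= j <= h)%N ->
    [/\ (i + j <= h)%N -> (j <= i)%N ->
          fusion2 (Pi i e) (Pi j true)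
            (Pi (i - j)%N (~~ e)) [:: l ^+ i *: (v \otv y); u \otv x]
            (Pi (i + j)%N (~~ e)) [:: l ^+ i *: (v \otv x); u \otv y],
        (i + j <= h)%N -> (i <= j)%N ->
          fusion2 (Pi i e) (Pi j true)
            (Pi (j - i)%N (~~ e)) [:: u \otv x; l ^+ i *: (v \otv y)]
            (Pi (i + j)%N (~~ e)) [:: l ^+ i *: (v \otv x); u \otv y],
        (h < i + j)%N -> (j <= i)%N ->
          fusion2 (Pi i e) (Pi j true)
            (Pi (i - j)%N (~~ e)) [:: l ^+ i *: (v \otv y); u \otv x]
            (Pi (m - i - j)%N (~~ e)) [:: u \otv y; l ^+ i *: (v \otv x)] &
        (h < i + j)%N -> (i <= j)%N ->
          fusion2 (Pi i e) (Pi j true)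
            (Pi (j - i)%N (~~ e)) [:: u \otv x; l ^+ i *: (v \otv y)]
            (Pi (m - i - j)%N (~~ e)) [:: u \otv y; l ^+ i *: (v \otv x)]]) /\
  (forall (i : nat) (al e d : bool), (1 <= i <= h)%N ->
    [/\ fusion1 (T al e) (Pi i d)
          (Pi i (e (+) d)) [:: t \otv u; sgn R al *: (t \otv v)],
        fusion1 (Pi i d) (T al false)
          (Pi i d) [:: u \otv t; sgn R al *: (v \otv t)] &
        fusion1 (Pi i d) (T al true)
          (Pi i (~~ d)) [:: l ^+ i *: (v \otv t); sgn R al *: (u \otv t)]]) /\
  (forall al e d : bool,
    fusion1 (T al e) (T false d) (T al (e (+) d)) [:: t \otv s] /\
    fusion1 (T al e) (T true d) (T (~~ al) (e (+) d)) [:: t \otv s]).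
Proof.
move=> h l u v x y t s Pi T.
have le_m i j : (1 <= i <= h)%N -> (1 <= j <= h)%N -> (i + j <= m)%N.
  by rewrite /h; lia.
split; [|split; [|split]].
- move=> i j e Hi Hj; apply: pi_fusion2_cases; first exact: le_m.
  + exact: pi_pi_antidiag.
  + exact: pi_pi_diag.
  + apply: (@full_pi_pi R _ 1); rewrite ?oner_eq0 ?scale1r //;
      by apply: memv_span; rewrite !inE eqxx ?orbT.
- move=> i j e Hi Hj; apply: pi_fusion2_cases; first exact: le_m.
  + exact: pi_pi_twisted_diag.
  + exact: pi_pi_twisted_antidiag.
  + apply: (full_pi_pi (lX_neq0 R m i));
      by apply: memv_span; rewrite !inE eqxx ?orbT.
- move=> i al e d _; split.
  + apply: pi_fusion1; [by [] | exact: T_pi_pair | apply: full_T_pi].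
      by apply: memv_span; rewrite mem_head.
    by apply: (mem_span_scale (sgn_neq0 R al)); rewrite !inE eqxx orbT.
  + apply: pi_fusion1; [by [] | exact: pi_T_pair | apply: full_pi_T].
      by apply: memv_span; rewrite mem_head.
    by apply: (mem_span_scale (sgn_neq0 R al)); rewrite !inE eqxx orbT.
  + apply: pi_fusion1; [by [] | exact: pi_T_twisted_pair | apply: full_pi_T].
      by apply: (mem_span_scale (sgn_neq0 R al)); rewrite !inE eqxx orbT.
    by apply: (mem_span_scale (lX_neq0 R m i)); rewrite mem_head.
- move=> al e d; rewrite -addbT; split; last exact: T_T_fusion.
  by have := T_T_fusion R m al e false d; rewrite addbF.
Qed.
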